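(* Consider charging $N$ $d$-level batteries from $\rho^{\otimes N}$ to $\sigma^{\otimes N}$ by a circuit-based procedure with interaction order at most $k$: the interval $[0,T_\sharp]$ is divided into finitely many steps, and during each step the collective Hamiltonian is $\bm H=\sum_{\mu=1}^{s}h_\mu$, $s=\lceil N/k\rceil$, where the $h_\mu$ act on pairwise disjoint sets of at most $k$ batteries (the partition may change from step to step). If the procedure satisfies constraint (C0), then the quantum advantage satisfies $\Gamma_{\rm C0}<\gamma k$, where $\gamma$ is a constant depending only on the single-battery data ($I$, $\rho$, $\sigma$, and the optimal single-battery charging protocol) and not on $N$. When $\rho$ is the ground state and $\sigma$ the maximally excited state of $I$, one may take $\gamma=\pi/2$.
   Context: Each battery is a $d$-level system with internal Hamiltonian $I^{(j)}=\sum_{l=1}^d\lambda_l|l\rangle_j\langle l|_j$, eigenvalues increasing, with $\lambda_d-\lambda_1=2\lambda_d>0$; the total internal Hamiltonian is $\bm I=\sum_j I^{(j)}$. Charging is unitary evolution under the time-dependent Hamiltonian; work is $W=\mathrm{tr}[\bm I(\text{final}-\text{initial})]$. The quantum advantage is $\Gamma=T_\|/T_\sharp$, where $T_\|$ is the optimal time to take $\rho$ to $\sigma$ with a single-battery Hamiltonian $H(t)$ (charging the $N$ batteries in parallel) and $T_\sharp$ the time of the collective protocol taking $\rho^{\otimes N}$ to $\sigma^{\otimes N}$. Constraint (C0): $\frac1{T_\sharp}\int_0^{T_\sharp}\|\bm H\|_{\rm op}dt\le N\,\frac1{T_\|}\int_0^{T_\|}\|H\|_{\rm op}dt$, where $\|\cdot\|_{\rm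 op}$ is the largest singular value. *)

(* Defs.v *)
(* Scalars: R : realType, complex numbers R[i]
   (mathcomp-real-closed), finite-dimensional Hilbert spaces as column vectors. *)
From HB Require Import structures.
From mathcomp Require Import all_boot all_order all_algebra.
From mathcomp Require Import all_classical all_reals all_analysis.
From mathcomp Require Import complex.
Set Implicit Arguments. Unset Strict Implicit. Unset Printing Implicit Defensive.
Import Order.TTheory GRing.Theory Num.Theory.
Import numFieldNormedType.Exports.
Local Open Scope ring_scope.
Local Open Scope classical_set_scope.

Section QB.
Variable R : realType.
Local Notation C := R[i].

(* real and imaginary parts (fields of the record complex) *)
Definition reC (z : C) : R := complex.Re z.
Definition imC (z : C) : R := complex.Im z.

(* conjugate transpose *)
Definition adj m n (A : 'M[C]_(m, n)) : 'M[C]_(n, m) := (map_mx (fun z => z^*) A)^T.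

Definition hermitian n (A : 'M[C]_n) : Prop := adj A = A.

(* density matrix: Hermitian, positive semidefinite, unit trace *)
Definition density n (rho : 'M[C]_n) : Prop :=
  hermitian rho /\ \tr rho = 1 /\
  (forall v : 'cV[C]_n, 0 <= (adj v *m rho *m v) 0 0).

(* operator norm = largest singular value of A, i.e. the largest s >= 0 such
   that s^2 is an eigenvalue of A^dagger A *)
Definition opnorm n (A : 'M[C]_n) : R :=
  sup [set s : R | 0 <= s /\ eigenvalue (adj A *m A) ((s ^+ 2)%:C)%C].

(* ---- unitary evolution under a time-dependent Hamiltonian ---- *)

(* on the time step [a,b]: U is continuous on [a,b] and solves
   dU/dt = -i H(t) U(t) on (a,b) (entrywise, real and imaginary parts) *)
Definition schrod_step n (H U : R -> 'M[C]_n) (a b : R) : Prop :=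
  forall i j : 'I_n,
    {within `[a, b], continuous (fun t => reC (U t i j))} /\
    {within `[a, b], continuous (fun t => imC (U t i j))} /\
    (forall t, a < t < b ->
       is_derive t 1 (fun s => reC (U s i j)) (reC ((- 'i%C *: (H t *m U t)) i j)) /\
       is_derive t 1 (fun s => imC (U s i j)) (imC ((- 'i%C *: (H t *m U t)) i j))).

(* 0 = tau 0 < tau 1 < ... < tau m = T : division of [0,T] into m steps *)
Definition time_steps (T : R) (m : nat) (tau : nat -> R) : Prop :=
  tau 0%N = 0 /\ tau m = T /\ (forall r, (r < m)%N -> tau r < tau r.+1).

(* U is the propagator of H on [0,T] (piecewise on the steps tau) *)
Definition propagator n (H U : R -> 'M[C]_n) (T : R) (m : nat) (tau : nat -> R) : Prop :=
  time_steps T m tau /\ U 0 = 1%:M /\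
  (forall r, (r < m)%N -> schrod_step H U (tau r) (tau r.+1)).

(* integral of the operator norm of H over [0,T] (extended real) *)
Definition norm_integral n (H : R -> 'M[C]_n) (T : R) : \bar R :=
  (\int[lebesgue_measure]_(t in `[0%R, T]) (opnorm (H t))%:E)%E.

Definition norm_integrable n (H : R -> 'M[C]_n) (T : R) : Prop :=
  lebesgue_measure.-integrable `[0, T] (fun t => (opnorm (H t))%:E).

(* a (physical) protocol driving rho to sigma in time T with Hamiltonian H *)
Definition drives n (rho sigma : 'M[C]_n) (H : R -> 'M[C]_n) (T : R) : Prop :=
  0 < T /\ (forall t, hermitian (H t)) /\ norm_integrable H T /\
  exists (U : R -> 'M[C]_n) m tau,
    propagator H U T m tau /\ U T *m rho *m adj (U T) = sigma.

(* (H, T) is a time-optimal single-battery protocol: no protocol with at most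
   the same time-averaged operator norm reaches sigma faster *)
Definition optimal_protocol n (rho sigma : 'M[C]_n) (H : R -> 'M[C]_n) (T : R) : Prop :=
  drives rho sigma H T /\
  forall (H' : R -> 'M[C]_n) (T' : R), drives rho sigma H' T' ->
    ((T'^-1)%:E * norm_integral H' T' <= (T^-1)%:E * norm_integral H T)%E -> T <= T'.

(* ---- N batteries ---- *)

(* computational basis of N d-level batteries: configurations 'I_N -> 'I_d *)
Definition cfg (d N : nat) := {ffun 'I_N -> 'I_d}.
Definition dimN (d N : nat) := #|{: cfg d N}|.
Definition cfg_of d N (i : 'I_(dimN d N)) : cfg d N := enum_val i.

(* tensor power rho^{\otimes N} *)
Definition tpow d (rho : 'M[C]_d) (N : nat) : 'M[C]_(dimN d N) :=
  \matrix_(i, j) \prod_(l < N) rho (cfg_of i l) (cfg_of j l).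

(* h acts only on the batteries in S, i.e. h = h_S \otimes 1_{complement of S} *)
Definition acts_on d N (S : {set 'I_N}) (h : 'M[C]_(dimN d N)) : Prop :=
  (forall i j, (exists l, l \notin S /\ cfg_of i l <> cfg_of j l) -> h i j = 0) /\
  (forall i j i' j',
     (forall l, l \in S -> cfg_of i l = cfg_of i' l /\ cfg_of j l = cfg_of j' l) ->
     (forall l, l \notin S -> cfg_of i l = cfg_of j l /\ cfg_of i' l = cfg_of j' l) ->
     h i j = h i' j').

Definition ceil_div (N k : nat) : nat := ((N + k.-1) %/ k)%N.

(* circuit-based collective protocol with interaction order at most k:
   on step r (time interval (tau r, tau r.+1)) the Hamiltonian is
   sum_{mu < s} h r mu t, s = ceil(N/k), with h r mu t acting on S r mu,
   the S r mu being pairwise disjoint sets of at most k batteries *)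
Definition circuit_protocol d N k (Hs : R -> 'M[C]_(dimN d N)) (T : R) (m : nat)
    (tau : nat -> R) (S : nat -> 'I_(ceil_div N k) -> {set 'I_N})
    (h : nat -> 'I_(ceil_div N k) -> R -> 'M[C]_(dimN d N)) : Prop :=
  time_steps T m tau /\
  forall r, (r < m)%N ->
    (forall mu nu, mu != nu -> [disjoint S r mu & S r nu]%B) /\
    (forall mu, (#|S r mu| <= k)%N) /\
    (forall mu t, acts_on (S r mu) (h r mu t) /\ hermitian (h r mu t)) /\
    (forall t, tau r < t < tau r.+1 -> Hs t = \sum_mu h r mu t).

(* Gamma_C0 < gamma * k for every circuit protocol with interaction order <= k
   satisfying (C0), for every number N >= 1 of batteries *)
Definition advantage_bound d (rho sigma : 'M[C]_d) (Hp : R -> 'M[C]_d) (Tp : R)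
    (gamma : R) : Prop :=
  forall (N k : nat) (Hs : R -> 'M[C]_(dimN d N)) (Ts : R) (m : nat) (tau : nat -> R)
         (S : nat -> 'I_(ceil_div N k) -> {set 'I_N})
         (h : nat -> 'I_(ceil_div N k) -> R -> 'M[C]_(dimN d N))
         (U : R -> 'M[C]_(dimN d N)),
    (0 < N)%N -> (0 < k)%N -> 0 < Ts ->
    circuit_protocol Hs Ts m tau S h ->
    norm_integrable Hs Ts ->
    propagator Hs U Ts m tau ->
    U Ts *m tpow rho N *m adj (U Ts) = tpow sigma N ->
    (* constraint (C0) *)
    ((Ts^-1)%:E * norm_integral Hs Ts <= (N%:R / Tp)%:E * norm_integral Hp Tp)%E ->
    Tp / Ts < gamma * k%:R.

End QB.

(* Main.v *)
(* Let A be a reflection (A^2 = 1) of one battery, A_l its copy on battery l, and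
   f(t) the expectation of the sum of the A_l in the evolved state.  The derivative
   of f is the expectation of i[H, sum_l A_l].  If L contains at most one battery of
   each block and V is the product over L of the unitaries (1 + i A_l) / sqrt 2, then
   i[H, sum_(l in L) A_l] = V^* H V - V H V^*, whose expectation is at most 2 ||H||;
   numbering the batteries inside each block covers all batteries by k such sets, so
   |f'| <= 2 k ||H||.  Integrating and inserting (C0) bounds the advantage by a
   constant times k, for A the sign of sigma - rho.  For the flip from the ground
   state to the top state f goes from -N to N; the bound is strict because |f'| is
   much smaller while f is close to -N, and comparing the optimal single-battery
   protocol with the two-level flip E(|0><max| + |max><0|) gives pi / 2.
   The norm of H is merely integrable, so the mean value inequality for f needs a
   lower semicontinuous majorant of its derivative. *)
From Pilot Require Import Defs.
From HB Require Import structures.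
From mathcomp Require Import all_boot all_order all_algebra.
From mathcomp Require Import all_classical all_reals all_analysis.
From mathcomp Require Import complex ring lra measurable_realfun.
Set Implicit Arguments. Unset Strict Implicit. Unset Printing Implicit Defensive.
Import Order.TTheory GRing.Theory Num.Theory.
Import numFieldNormedType.Exports.
(* [hermitian] is shadowed by MathComp's sesquilinear forms. *)
Import Pilot.Defs.
Local Open Scope ring_scope.
Local Open Scope classical_set_scope.

(** * A mean value inequality for integrable bounds on the slope *)

(** A supremum argument: the points [x] with [psi x <= psi c] have a supremum, which belongs to the
    set by the left half of the local condition and equals [d] by the right half. The left half
    takes the place of continuity of [psi]. *)
Lemma locally_nonincreasing_le (R : realType) (psi : R -> R) (c d : R) : c <= d ->
  (forall x, c <= x <= d -> exists2 e, 0 < e &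
     (forall y, x < y < x + e -> y <= d -> psi y <= psi x) /\
     (forall y, x - e < y < x -> c <= y -> psi x <= psi y)) ->
  psi d <= psi c.
Proof.
move=> cd loc.
pose S := [set x | c <= x <= d /\ psi x <= psi c].
have Sc : S c by split; rewrite ?lexx.
have Sd : ubound S d by move=> x [/andP[]].
have hsS : has_sup S by split; [exists c | exists d].
have subS x : S x -> x <= sup S.
  by move=> Sx; have hu : has_ubound S by [exists d]; exact: ub_le_sup hu _ Sx.
have cs : c <= sup S by exact: subS Sc.
have sd : sup S <= d by apply: ge_sup Sd; exists c.
have [e e0 [rgt lft]] := loc (sup S) (introT andP (conj cs sd)).
have Ss : psi (sup S) <= psi c.
  have [x [/andP[cx xd] px] ex] := sup_adherent e0 hsS.
  have : x <= sup S by apply: subS; split; rewrite ?cx.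
  rewrite le_eqVlt => /orP[/eqP<- //|xs].
  by apply: le_trans px; apply: lft; rewrite ?ex.
have [sd'|] := ltP (sup S) d; last first.
  by move=> ds; have -> : d = sup S by apply/eqP; rewrite eq_le ds sd.
pose y := Num.min d (sup S + e / 2).
have sy : sup S < y by rewrite lt_min sd' /= ltrDl divr_gt0.
have yd : y <= d by rewrite ge_min lexx.
have ys : y < sup S + e by rewrite gt_min ltrD2l gtr_pMr ?invf_lt1 ?ltr1n ?orbT.
have Sy : S y.
  split; first by rewrite (le_trans cs (ltW sy)) yd.
  by apply: le_trans Ss; apply: rgt; rewrite ?sy.
have := subS _ Sy.
by rewrite leNgt sy.
Qed.

Section local_lipschitz.
Variable R : realType.
Local Notation mu := (@lebesgue_measure R).

(* The constants [e *+ j.+2] on the open sets [V j] form a lower semicontinuous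
   majorant of [g], as in the Vitali-Caratheodory theorem. *)
Lemma open_level_cover (g : R -> R) (a b e : R) : a < b -> 0 < e ->
  (forall t, 0 <= g t) -> measurable_fun `[a, b] g ->
  exists V : nat -> set R,
    [/\ forall j, open (V j),
        forall x, a < x < b -> exists2 j, V j x & g x + e <= e *+ j.+2 &
        (\sum_(j <oo) ((e *+ j.+2)%:E * mu (V j)) <=
         \int[mu]_(t in `[a, b]) (g t)%:E + (e * 2 * (b - a) + e)%:E)%E].
Proof.
move=> ab e0 g0 mg.
pose D := `]a, b[%classic : set R.
have mD : measurable D by exact: measurable_itv.
have mgD : measurable_fun D g.
  apply: measurable_funS mg; first exact: measurable_itv.
  exact: subset_itv_oo_cc.
(* Level sets of [g] with mesh [e]; [V j] will be an open set around [E j] of slightly larger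
   measure. *)
pose E j := D `&` g @^-1` `[e *+ j, e *+ j.+1[%classic.
have mE j : measurable (E j) by apply: mgD; exact: measurable_itv.
have muD : mu D = (b - a)%:E.
  by rewrite /D lebesgue_measure_itv /= lte_fin ab.
have muE j : (mu (E j) < +oo)%E.
  apply: (@le_lt_trans _ _ (mu D)); last by rewrite muD ltry.
  apply: le_measure; rewrite ?inE //.
    exact: mE.
  exact: subIsetl.
(* The excess of [V j] over [E j] is counted with weight [e *+ j.+2]; this choice makes the total
   weighted excess at most [e]. *)
pose eps j : R := ((e *+ j.+2)^-1 * (e / (2 ^ j.+1)%:R)).
have c0 j : 0 < e *+ j.+2 by rewrite pmulrn_lgt0.
have eps0 j : 0 < eps j by rewrite mulr_gt0 ?invr_gt0 ?divr_gt0.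
have /= HV j := lebesgue_regularity_outer (mE j) (muE j) (eps0 j).
pose V j := projT1 (cid (HV j)).
have VP j : [/\ open (V j), E j `<=` V j & (mu (V j `\` E j) < (eps j)%:E)%E].
  by rewrite /V; case: cid.
exists V; split.
- by move=> j; case: (VP j).
- move=> x xab.
  (* The floor of [g x / e] is the level of [x]; the shift to [j.+2] leaves room for the extra
     [e]. *)
  pose j := Num.truncn (g x / e).
  have /andP[j1 j2] : (j%:R <= g x / e < j.+1%:R).
    by rewrite /j truncn_itv // divr_ge0 // ltW.
  have gj : g x < e *+ j.+1 by rewrite -mulr_natl -ltr_pdivrMr.
  exists j; last by rewrite (mulrSr _ j.+1) lerD2r ltW.
  case: (VP j) => _ sub _; apply: sub; split => //=.
  rewrite in_itv /=; apply/andP; split => //.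
  by rewrite -mulr_natl -ler_pdivlMr.
- have muV j : ((e *+ j.+2)%:E * mu (V j) <=
      (e *+ j.+2)%:E * mu (E j) + (e / (2 ^ j.+1)%:R)%:E)%E.
    have [oV EV lt] := VP j.
    have -> : V j = E j `|` (V j `\` E j) by rewrite setDUK.
    rewrite measureU //; last by rewrite setDIK.
    - rewrite ge0_muleDr // leeD2l //.
      apply: (@le_trans _ _ ((e *+ j.+2)%:E * (eps j)%:E)%E).
        by rewrite lee_wpmul2l ?lee_fin // ltW.
      by rewrite -EFinM /eps mulrA divff ?mul1r // gt_eqF.
    - exact: mE.
    - by apply: measurableD; [exact: open_measurable | exact: mE].
  apply: le_trans (lee_nneseries _ (fun j _ => muV j)) _.
    by move=> i _ _; rewrite mule_ge0 // lee_fin ltW.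
  apply: le_trans (epsilon_trick _ _ _) _.
  + by move=> i; rewrite mule_ge0 // lee_fin ltW.
  + exact: ltW.
  rewrite EFinD addeA leeD2r //.
  have DE : \bigcup_j E j = D.
    apply/seteqP; split => [x [j _ []] //|x Dx].
    exists (Num.truncn (g x / e)) => //; split => //=.
    have /andP[j1 j2] : ((Num.truncn (g x / e))%:R <= g x / e < (Num.truncn (g x / e)).+1%:R).
      by rewrite truncn_itv // divr_ge0 // ltW.
    by rewrite in_itv /= -[e *+ _]mulr_natl -ler_pdivlMr // j1 /= -mulr_natl -ltr_pdivrMr.
  have tE : trivIset setT E.
    apply/trivIsetP => i j _ _ ij; apply/seteqP; split => // x [[_ /=]].
    rewrite in_itv /= => /andP[i1 i2] [_ /=]; rewrite in_itv /= => /andP[j1 j2].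
    have := le_lt_trans i1 j2; have := le_lt_trans j1 i2.
    by rewrite !ltr_pMn2l // !ltnS => ji ij'; move: ij; rewrite neq_ltn !ltnNge ji ij'.
  have mge : measurable_fun D (fun x => (g x + e * 2)%:E).
    by apply/measurable_EFinP; apply: measurable_funD.
  apply: (@le_trans _ _ (\sum_(j <oo) \int[mu]_(x in E j) (g x + e * 2)%:E)%E).
    apply: lee_nneseries => [i _ _|i _].
      by rewrite mule_ge0 // lee_fin ltW.
    have -> : ((e *+ i.+2)%:E * mu (E i) = \int[mu]_(x in E i) (e *+ i.+2)%:E)%E.
      by rewrite integral_cst //; exact: mE.
    apply: ge0_le_integral; first exact: mE.
    + by move=> x _; rewrite lee_fin ltW.
    + exact: measurable_cst.
    + by apply: measurable_funS mge => //; rewrite -DE; exact: bigcup_sup.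
    (* On [E i] the constant exceeds [g] by at most [2 * e], whence the error [e * 2 * (b - a)]. *)
    + move=> x [_ /=]; rewrite in_itv /= => /andP[h _].
      by rewrite lee_fin !mulrS -mulr_natr; lra.
  rewrite -ge0_integral_bigcup //; last 2 first.
  + by rewrite DE.
  + by move=> x _; rewrite lee_fin addr_ge0 // mulr_ge0 // ltW.
  rewrite DE; under eq_integral do rewrite EFinD.
  rewrite ge0_integralD //.
  + rewrite integral_cst; last exact: mD.
    rewrite [X in (_ + _ * X <= _)%E](_ : _ = (b - a)%:E)%E; last exact: muD.
    rewrite -EFinM leeD2r //.
    rewrite [leLHS](_ : _ = \int[mu]_(t in `[a, b]) (g t)%:E)%E //.
    by rewrite -(@integral_itv_bndoo _ a b _ true false) //; exact/measurable_EFinP.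
  + by move=> x _; rewrite lee_fin.
  + exact/measurable_EFinP.
  + by move=> x _; rewrite lee_fin mulr_ge0 // ltW.
Qed.

Lemma open_ball_sub (V : set R) x : open V -> V x ->
  exists2 d, 0 < d & forall y, `|y - x| < d -> V y.
Proof.
move=> oV Vx; have /nbhs_ballP[d d0 sub] : nbhs x V by exact: open_nbhs_nbhs.
by exists d => // y yx; apply: sub; rewrite /ball /= distrC.
Qed.

(** With [G x y] the integral over []x, y]] of the majorant, [F] minus [G c] is locally
    nonincreasing: an open [V j] around [x] makes [G] grow at rate at least [g x + e] near [x]. The
    total growth of [G] is at most the right-hand side. *)
Lemma locally_lipschitz_le_integral_oo (F g : R -> R) (a b e c d : R) : a < b -> 0 < e ->
  (forall t, 0 <= g t) -> mu.-integrable `[a, b] (fun t => (g t)%:E) ->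
  (forall x, a < x < b -> forall e : R, 0 < e -> exists2 d : R, 0 < d &
     forall y, `|y - x| < d -> `|F y - F x| <= (g x + e) * `|y - x|) ->
  a < c -> c <= d -> d < b ->
  ((F d - F c)%:E <= \int[mu]_(t in `[a, b]) (g t)%:E + (e * 2 * (b - a) + e)%:E)%E.
Proof.
move=> ab e0 g0 ig loc ac cd db.
have mg : measurable_fun `[a, b] g.
  by apply/measurable_EFinP; exact: measurable_int ig.
have [V [oV Vg sV]] := open_level_cover ab e0 g0 mg.
set K := (\int[mu]_(t in _) _ + _)%E in sV *.
have Kfin : K \is a fin_num.
  by rewrite fin_numD /= andbT; exact: integrable_fin_num ig.
have c0 j : (0 <= (e *+ j.+2)%:E)%E by rewrite lee_fin mulrn_wge0 // ltW.
have mV j : measurable (V j) by exact: open_measurable.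
pose J x y : set R := `]x, y]%classic.
have mVJ j x y : measurable (V j `&` J x y).
  by apply: measurableI => //; exact: measurable_itv.
pose G x y := (\sum_(j <oo) ((e *+ j.+2)%:E * mu (V j `&` J x y)))%E.
have t0 x y j : (0 <= (e *+ j.+2)%:E * mu (V j `&` J x y))%E.
  by rewrite mule_ge0.
have G0 x y : (0 <= G x y)%E by apply: nneseries_ge0 => *; exact: t0.
have GK x y : (G x y <= K)%E.
  apply: le_trans sV; apply: lee_nneseries => [j _ _|j _]; first exact: t0.
  by rewrite lee_wpmul2l // le_measure ?inE //;
    [exact: mVJ | exact: mV].
have Gfin x y : G x y \is a fin_num.
  by rewrite ge0_fin_numE // (le_lt_trans (GK x y)) // ltey_eq Kfin.
have GD x y z : x <= y -> y <= z -> G x z = (G x y + G y z)%E.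
  move=> xy yz; rewrite /G -nneseriesD; [|by move=> *; exact: t0..].
  apply: eq_eseriesr => j _; rewrite -ge0_muleDr //; congr (_ * _)%E.
  rewrite -measureU //; [|exact: mVJ|exact: mVJ|].
    by rewrite -setIUr; congr (mu (_ `&` _)); rewrite /J -itv_bndbnd_setU // bnd_simp.
  apply/seteqP; split => // u [[_ /=]]; rewrite /J /= !in_itv /= => /andP[_ uy] [_].
  by rewrite ltNge uy.
(* A single term of the series suffices, because the whole interval lies in [V j]. *)
have Gge x y j : x <= y -> (forall u, x <= u <= y -> V j u) ->
    (((e *+ j.+2) * (y - x))%:E <= G x y)%E.
  move=> xy sub; apply: le_trans (nneseries_lim_ge j.+1 _); last by move=> *; exact: t0.
  rewrite big_nat_recr //=.
  apply: (@le_trans _ _ ((e *+ j.+2)%:E * mu (V j `&` J x y))%E); last first.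
    by apply: leeDr; apply: sume_ge0 => i _; exact: t0.
  have -> : V j `&` J x y = J x y.
    apply/setIidPr => u /=; rewrite /J /= in_itv /= => /andP[xu uy].
    by apply: sub; rewrite (ltW xu).
  rewrite EFinM /J lebesgue_measure_itv /= lte_fin.
  case: ltP => // yx; have -> : y = x by apply/eqP; rewrite eq_le xy yx.
  by rewrite subrr.
pose psi x := F x - fine (G c x).
have psiE x y : c <= x -> x <= y -> psi x - psi y = fine (G x y) - (F y - F x).
  move=> cx xy; rewrite /psi (GD c x y) // fineD //.
  by rewrite !opprD opprK !addrA; lra.
have : psi d <= psi c.
  apply: locally_nonincreasing_le => // x /andP[cx xd].
  have xab : a < x < b by rewrite (lt_le_trans ac cx) (le_lt_trans xd db).
  have [j Vjx gj] := Vg x xab.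
  have [d1 d10 H1] := open_ball_sub (oV j) Vjx.
  have [d2 d20 H2] := loc x xab e e0.
  pose d3 : R := Num.min d1 d2.
  have d30 : 0 < d3 by rewrite lt_min d10.
  exists d3 => //; split => y /andP[y1 y2] ycd.
  - have yx1 : `|y - x| < d1.
      by rewrite gtr0_norm ?subr_gt0 // ltrBlDl (lt_le_trans y2) // lerD2l ge_min lexx.
    have yx2 : `|y - x| < d2.
      by rewrite gtr0_norm ?subr_gt0 // ltrBlDl (lt_le_trans y2) // lerD2l ge_min lexx orbT.
    rewrite -subr_ge0 psiE ?(ltW y1) // subr_ge0.
    apply: le_trans (ler_norm _) _; apply: le_trans (H2 _ yx2) _.
    rewrite gtr0_norm ?subr_gt0 // -lee_fin fineK //.
    apply: le_trans (Gge x y j (ltW y1) _); last first.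
      move=> u /andP[xu uy]; apply: H1; rewrite ger0_norm ?subr_ge0 //.
      by move: yx1; rewrite gtr0_norm ?subr_gt0 // => /(le_lt_trans _); apply; rewrite lerD2r.
    by rewrite lee_fin ler_wpM2r // subr_ge0 ltW.
  - have yx1 : `|y - x| < d1.
      rewrite distrC gtr0_norm ?subr_gt0 // ltrBlDr -ltrBlDl (le_lt_trans _ y1) //.
      by rewrite lerD2l lerN2 ge_min lexx.
    have yx2 : `|y - x| < d2.
      rewrite distrC gtr0_norm ?subr_gt0 // ltrBlDr -ltrBlDl (le_lt_trans _ y1) //.
      by rewrite lerD2l lerN2 ge_min lexx orbT.
    rewrite -subr_ge0 psiE ?(ltW y2) // subr_ge0.
    apply: le_trans (ler_norm _) _; rewrite distrC; apply: le_trans (H2 _ yx2) _.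
    rewrite distrC gtr0_norm ?subr_gt0 // -lee_fin fineK //.
    apply: le_trans (Gge y x j (ltW y2) _); last first.
      move=> u /andP[yu ux]; apply: H1; rewrite distrC ger0_norm ?subr_ge0 //.
      move: yx1; rewrite distrC gtr0_norm ?subr_gt0 // => /(le_lt_trans _); apply.
      by rewrite lerD2l lerN2.
    by rewrite lee_fin ler_wpM2r // subr_ge0 ltW.
rewrite -subr_ge0 psiE // subr_ge0 -lee_fin fineK // => /le_trans; apply.
exact: GK.
Qed.

(** The estimate on inner intervals passes to the endpoints by continuity, and then [e] tends to
    zero. *)
Lemma locally_lipschitz_le_integral (F g : R -> R) (a b : R) : a < b ->
  {within `[a, b], continuous F} ->
  (forall t, 0 <= g t) -> mu.-integrable `[a, b] (fun t => (g t)%:E) ->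
  (forall x, a < x < b -> forall e : R, 0 < e -> exists2 d : R, 0 < d &
     forall y, `|y - x| < d -> `|F y - F x| <= (g x + e) * `|y - x|) ->
  ((F b - F a)%:E <= \int[mu]_(t in `[a, b]) (g t)%:E)%E.
Proof.
move=> ab cF g0 ig loc.
have [_ Fa Fb] := (continuous_within_itvP _ ab).1 cF.
have Ifin : (\int[mu]_(t in `[a, b]) (g t)%:E)%E \is a fin_num.
  exact: integrable_fin_num ig.
rewrite -(fineK Ifin) lee_fin; set I := fine _.
have step e : 0 < e -> F b - F a <= I + (e * 2 * (b - a) + e).
  move=> e0.
  have cd c d : a < c -> c <= d -> d < b -> F d - F c <= I + (e * 2 * (b - a) + e).
    move=> ac cd db; have := locally_lipschitz_le_integral_oo ab e0 g0 ig loc ac cd db.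
    by rewrite -(fineK Ifin) -EFinD lee_fin.
  pose m := (a + b) / 2.
  have am : a < m by rewrite /m; lra.
  have mb : m < b by rewrite /m; lra.
  have lft d : m <= d -> d < b -> F d - F a <= I + (e * 2 * (b - a) + e).
    move=> md db; have Fda : F d - F c @[c --> a^'+] --> F d - F a.
      by apply: cvgB => //; exact: cvg_cst.
    apply: (cvgr_to_le Fda); near=> c; apply: cd => //.
    apply: le_trans md; near: c; exact: nbhs_right_ltW.
  have Fba : F d - F a @[d --> b^'-] --> F b - F a.
    by apply: cvgB => //; exact: cvg_cst.
  apply: (cvgr_to_le Fba); near=> d; apply: lft => //; near: d; exact: nbhs_left_ge.
apply/ler_addgt0Pr => e e0.
have ba : 0 < 2 * (b - a) + 1 by rewrite addr_gt0 // mulr_gt0 // subr_gt0.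
(* This rescaling makes the error term exactly [e]. *)
have := step (e / (2 * (b - a) + 1)) (divr_gt0 e0 ba).
set k := (X in _ <= _ + X -> _); have -> // : k = e.
by rewrite /k -mulrA -{2}[e / _]mulr1 -mulrDr divfK // gt_eqF.
Unshelve. all: by end_near.
Qed.

End local_lipschitz.

(** * Hermitian and positive semidefinite matrices *)

Section adjoint.
Variable R : realType.
Local Notation C := R[i].

Lemma adjE m n (A : 'M[C]_(m, n)) i j : adj A i j = (A j i)^*.
Proof. by rewrite !mxE. Qed.

Lemma adjK m n (A : 'M[C]_(m, n)) : adj (adj A) = A.
Proof. by apply/matrixP => i j; rewrite !adjE conjCK. Qed.

Lemma adjD m n (A B : 'M[C]_(m, n)) : adj (A + B) = adj A + adj B.
Proof. by apply/matrixP => i j; rewrite !(adjE, mxE) rmorphD. Qed.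

Lemma adj_sum m n I (r : seq I) (A : I -> 'M[C]_(m, n)) :
  adj (\sum_(i <- r) A i) = \sum_(i <- r) adj (A i).
Proof.
elim/big_rec2: _ => [|i x y _ <-]; last by rewrite adjD.
by apply/matrixP => i j; rewrite !(adjE, mxE) rmorph0.
Qed.

Lemma adjZ m n c (A : 'M[C]_(m, n)) : adj (c *: A) = c^* *: adj A.
Proof. by apply/matrixP => i j; rewrite !(adjE, mxE) rmorphM. Qed.

Lemma adjN m n (A : 'M[C]_(m, n)) : adj (- A) = - adj A.
Proof. by apply/matrixP => i j; rewrite !(adjE, mxE) rmorphN. Qed.

Lemma adjM m n p (A : 'M[C]_(m, n)) (B : 'M[C]_(n, p)) :
  adj (A *m B) = adj B *m adj A.
Proof.
apply/matrixP => i j; rewrite !(adjE, mxE) rmorph_sum; apply: eq_bigr => k _.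
by rewrite !adjE rmorphM mulrC.
Qed.

Lemma adj_scalar n (c : C) : adj c%:M = (c^* )%:M :> 'M[C]_n.
Proof. by apply/matrixP => i j; rewrite !(adjE, mxE) eq_sym rmorphMn. Qed.

Lemma adj1 n : adj 1%:M = 1%:M :> 'M[C]_n.
Proof. by rewrite adj_scalar rmorph1. Qed.

Definition psd n (P : 'M[C]_n) := forall v : 'cV[C]_n, 0 <= (adj v *m P *m v) 0 0.

Lemma psd_conj m n (P : 'M[C]_n) (V : 'M[C]_(m, n)) : psd P -> psd (V *m P *m adj V).
Proof.
move=> psdP v; have := psdP (adj V *m v).
by rewrite adjM adjK !mulmxA.
Qed.

Lemma psd_diag n (P : 'M[C]_n) i : psd P -> 0 <= P i i.
Proof.
move=> /(_ (delta_mx i 0)); rewrite (_ : adj _ = delta_mx 0 i).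
  by rewrite -rowE -colE !mxE.
by apply/matrixP => k l; rewrite adjE !mxE andbC conjC_nat.
Qed.

(** The library's spectral decomposition, recast with [adj] and with real eigenvalues [d]. *)
Lemma hermitian_spectrum n (H : 'M[C]_n) : hermitian H ->
  exists (Q : 'M[C]_n) (d : 'I_n -> R),
   [/\ Q *m adj Q = 1%:M, adj Q *m Q = 1%:M &
       Q *m H = diag_mx (\row_i (d i)%:C)%C *m Q].
Proof.
move=> hH; have hs : H \is hermitianmx n false (@Num.Def.conjC C).
  apply/is_hermitianmxP; rewrite expr0 scale1r -[LHS]hH /adj.
  by apply/matrixP => i j; rewrite !mxE.
have sp := orthomx_spectralP (hermitian_normalmx hs).
have dr := hermitian_spectral_diag_real hs.
set Q := spectralmx H in sp; set D := spectral_diag H in sp dr.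
have uQ : Q \is unitarymx by exact: spectral_unitarymx.
have QQ : Q *m adj Q = 1%:M.
  move/unitarymxP: (uQ) => <-; congr (_ *m _).
  by apply/matrixP => i j; rewrite !mxE.
exists Q, (fun i => complex.Re (D 0 i)); split => //.
- exact: mulmx1C.
- rewrite {1}sp !mulmxA mulmxV ?spectral_unit // mul1mx; congr (diag_mx _ *m _).
  apply/rowP => i; rewrite !mxE RRe_real //.
  by move/mxOverP: dr.
Qed.

(** In the eigenbasis [A^* A] is diagonal with entries [d i ^+ 2], and a nonzero coordinate of an
    eigenvector singles out one of them. This bounds the set whose supremum is [opnorm A]. *)
Lemma opnorm_set_bound n (A : 'M[C]_n) (Q : 'M[C]_n) (d : 'I_n -> R) (s : R) :
  Q *m adj Q = 1%:M -> adj Q *m Q = 1%:M ->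
  hermitian A -> Q *m A = diag_mx (\row_i (d i)%:C)%C *m Q ->
  0 <= s -> eigenvalue (adj A *m A) ((s ^+ 2)%:C)%C ->
  exists i, s = `|d i|.
Proof.
move=> QQ' Q'Q hA QA s0 /eigenvalueP[v vA v0].
rewrite hA in vA.
have AQ : A *m adj Q = adj Q *m diag_mx (\row_i (d i)%:C)%C.
  by rewrite -[LHS]mul1mx -Q'Q -mulmxA (mulmxA Q) QA -mulmxA QQ' mulmx1.
pose w := v *m adj Q.
have w0 : w != 0.
  apply: contra v0 => /eqP w0.
  by rewrite -[v]mulmx1 -Q'Q mulmxA -/w w0 mul0mx.
have [i wi] : exists i, w 0 i != 0.
  apply/existsP; apply: contraR w0; rewrite negb_exists => /forallP w0.
  by apply/eqP/rowP => i; rewrite [RHS]mxE; apply/eqP; move: (w0 i); rewrite negbK.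
have : (w *m diag_mx (\row_i (d i)%:C)%C *m diag_mx (\row_i (d i)%:C)%C) 0 i
   = ((s ^+ 2)%:C)%C * w 0 i.
  rewrite /w -(mulmxA v) -AQ mulmxA -(mulmxA _ (adj Q)) -AQ !mulmxA.
  by rewrite -(mulmxA v) vA -scalemxAl mxE.
clearbody w; rewrite !mul_mx_diag !mxE -mulrA [LHS]mulrC => ds0.
have {ds0} := mulIf wi ds0; rewrite -rmorphM => /complexI ds; exists i.
by rewrite -sqrtr_sqr expr2 ds sqrtr_sqr ger0_norm.
Qed.

(** Row [i] of [Q] is an eigenvector of [A^* A]; the sum of the absolute eigenvalues bounds the set,
    so its supremum is a true upper bound. *)
Lemma opnorm_ge_spectrum n (A : 'M[C]_n) (Q : 'M[C]_n) (d : 'I_n -> R) i :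
  Q *m adj Q = 1%:M -> adj Q *m Q = 1%:M ->
  hermitian A -> Q *m A = diag_mx (\row_i (d i)%:C)%C *m Q ->
  `|d i| <= opnorm A.
Proof.
move=> QQ' Q'Q hA QA.
apply: ub_le_sup.
  exists (\sum_j `|d j|) => s [s0 es].
  have [j ->] := opnorm_set_bound QQ' Q'Q hA QA s0 es.
  by rewrite (bigD1 j) //= lerDl sumr_ge0.
split=> //; apply/eigenvalueP; exists (row i Q).
  rewrite hA mulmxA -row_mul QA row_mul; rewrite -!row_mul.
  rewrite -mulmxA QA mulmxA; apply/rowP => j.
  rewrite !mxE /= (bigD1 i) //= big1 ?addr0.
    rewrite !mxE (bigD1 i) //= big1 ?addr0; last first.
      by move=> k ki; rewrite !mxE eq_sym (negPf ki) mulr0n mul0r.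
    by rewrite !mxE eqxx !mulr1n -rmorphM -expr2 real_normK // num_real.
  move=> k ki; rewrite !mxE big1 ?mul0r // => l _.
  rewrite !mxE; case: (eqVneq i l) => [<-|]; last by rewrite mulr0n mul0r.
  by rewrite eq_sym (negPf ki) mulr0n mulr0.
apply/eqP => r0; have := congr1 (fun M : 'M[C]_n => M i i) QQ'.
rewrite !mxE eqxx big1 => [/esym/eqP|j _]; first by rewrite oner_eq0.
by have /rowP/(_ j) := r0; rewrite !mxE => ->; rewrite mul0r.
Qed.

Lemma opnorm_ge0 n (A : 'M[C]_n) : 0 <= opnorm A.
Proof.
rewrite /opnorm; set X := [set s | _].
(* By convention [sup] is 0 on empty and on unbounded sets. *)
have [[s Xs]|/set0P/negP/negPn/eqP->] := pselect (X !=set0); last by rewrite sup0.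
have [hs|/sup_out->] // := pselect (has_sup X).
by apply: le_trans (sup_upper_bound hs Xs); case: Xs.
Qed.

(** In an eigenbasis of [H] the trace is a sum of eigenvalues weighted by the diagonal of [P], which
    is nonnegative and sums to the trace of [P]. *)
Lemma mxtrace_hermitian_psd n (H P : 'M[C]_n) : hermitian H -> psd P ->
  `|reC (\tr (H *m P))| <= opnorm H * reC (\tr P).
Proof.
move=> hH pP; have [Q [d [QQ' Q'Q QH]]] := hermitian_spectrum hH.
pose P' := Q *m P *m adj Q.
have pP' : psd P' by exact: psd_conj.
have trP : \tr P = \tr P' by rewrite /P' mxtrace_mulC mulmxA Q'Q mul1mx.
have -> : \tr (H *m P) = \sum_i (d i)%:C%C * P' i i.
  rewrite -[H *m P]mul1mx -Q'Q -mulmxA (mulmxA Q) QH mxtrace_mulC -!mulmxA.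
  rewrite mul_diag_mx; apply: eq_bigr => i _.
  by rewrite mxE [X in X * _]mxE /P' -mulmxA.
have rP i : P' i i = (complex.Re (P' i i))%:C%C.
  by rewrite RRe_real // ger0_real // psd_diag.
have P0 i : 0 <= complex.Re (P' i i) by rewrite -ler0c -rP psd_diag.
have -> : \sum_i (d i)%:C%C * P' i i = (\sum_i d i * complex.Re (P' i i))%:C%C.
  by rewrite rmorph_sum; apply: eq_bigr => i _; rewrite rP -rmorphM.
have -> : \tr P = (\sum_i complex.Re (P' i i))%:C%C.
  by rewrite trP rmorph_sum; apply: eq_bigr => i _; rewrite {1}rP.
rewrite /reC /= mulr_sumr; apply: le_trans (ler_norm_sum _ _ _) _.
apply: ler_sum => i _; rewrite normrM (ger0_norm (P0 i)) ler_wpM2r //.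
exact: opnorm_ge_spectrum QQ' Q'Q hH QH.
Qed.

(* A square root of the spectrum factors [P] as [B^* B]. *)
Lemma psd_factor n (P : 'M[C]_n) : hermitian P -> psd P ->
  exists B : 'M[C]_n, P = adj B *m B.
Proof.
move=> hP pP; have [Q [d [QQ' Q'Q QP]]] := hermitian_spectrum hP.
have d0 i : 0 <= d i.
  have := psd_diag i (psd_conj Q pP).
  by rewrite QP -mulmxA QQ' mulmx1 !mxE eqxx mulr1n ler0c.
exists (diag_mx (\row_i (Num.sqrt (d i))%:C%C) *m Q).
rewrite adjM -[P]mul1mx -Q'Q -mulmxA QP -!mulmxA; congr (_ *m _).
rewrite mulmxA; congr (_ *m _); apply/matrixP => i j.
rewrite mul_mx_diag mxE adjE !mxE eq_sym.
case: (eqVneq i j) => [->|]; last by rewrite !mulr0n conjC0 mul0r.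
rewrite !mulr1n (_ : _^* = (Num.sqrt (d j))%:C%C) -?rmorphM ?[_ * _]sqr_sqrtr //.
by apply/conj_Creal; rewrite ger0_real // ler0c sqrtr_ge0.
Qed.

End adjoint.

(** * Tensor products *)

Section tensor.
Variables (R : realType) (d N : nat).
Local Notation C := R[i].
Local Notation dim := (dimN d N).

Definition tens (B : 'I_N -> 'M[C]_d) : 'M[C]_dim :=
  \matrix_(i, j) \prod_(l < N) B l (cfg_of i l) (cfg_of j l).

Lemma sum_cfg (F : cfg d N -> C) : \sum_f F f = \sum_(i < dim) F (cfg_of i).
Proof.
rewrite (reindex (@cfg_of d N)) //=; apply: onW_bij.
by exists enum_rank; [exact: enum_valK | exact: enum_rankK].
Qed.

Lemma tensM A B : tens A *m tens B = tens (fun l => A l *m B l).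
Proof.
apply/matrixP => i j; rewrite !mxE.
under [RHS]eq_bigr do rewrite mxE.
rewrite bigA_distr_bigA /=.
rewrite sum_cfg.
by apply: eq_bigr => k _; rewrite !mxE -big_split.
Qed.

Lemma tens_tr B : \tr (tens B) = \prod_l \tr (B l).
Proof.
rewrite /mxtrace bigA_distr_bigA /=.
rewrite sum_cfg.
by apply: eq_bigr => k _; rewrite mxE.
Qed.

Lemma adj_tens B : adj (tens B) = tens (fun l => adj (B l)).
Proof.
apply/matrixP => i j; rewrite adjE !mxE rmorph_prod.
by apply: eq_bigr => l _; rewrite adjE.
Qed.

Lemma eq_tens A B : A =1 B -> tens A = tens B.
Proof. by move=> AB; apply/matrixP => i j; rewrite !mxE; apply: eq_bigr => l _; rewrite AB. Qed.

Lemma cfg_of_inj : injective (@cfg_of d N).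
Proof. exact: enum_val_inj. Qed.

Lemma cfg_neq (i j : 'I_dim) : i != j -> exists l, cfg_of i l != cfg_of j l.
Proof.
move=> ij; apply/existsP; apply: contraR ij; rewrite negb_exists => /forallP e.
by apply/eqP/cfg_of_inj/ffunP => l; apply/eqP; move: (e l); rewrite negbK.
Qed.

Lemma tens1 : tens (fun=> 1%:M) = 1%:M.
Proof.
apply/matrixP => i j; rewrite !mxE; case: eqVneq => [->|ij].
  by rewrite big1 // => l _; rewrite mxE eqxx.
have [l lij] := cfg_neq ij.
by rewrite (bigD1 l) //= mxE (negPf lij) mul0r.
Qed.

Definition site (A : 'M[C]_d) (l : 'I_N) := tens (fun l' => if l' == l then A else 1%:M).

Lemma siteM A B l : site A l *m site B l = site (A *m B) l.
Proof.
by rewrite tensM; apply: eq_tens => l'; case: eqP => // _; rewrite mulmx1.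
Qed.

Lemma site1 l : site 1%:M l = 1%:M.
Proof. by rewrite -tens1; apply: eq_tens => l'; case: eqP. Qed.

Lemma siteC A B l l' : l != l' -> site A l *m site B l' = site B l' *m site A l.
Proof.
move=> ll'; rewrite !tensM; apply: eq_tens => x.
have [->|] := eqVneq x l; first by rewrite (negPf ll') mulmx1 mul1mx.
by rewrite mulmx1 mul1mx.
Qed.

Lemma adj_site A l : hermitian A -> adj (site A l) = site A l.
Proof.
by move=> hA; rewrite adj_tens; apply: eq_tens => x; case: eqP => // _; rewrite adj1.
Qed.

Lemma site_tpow_tr A l rho : \tr rho = 1 ->
  \tr (site A l *m tpow rho N) = \tr (A *m rho).
Proof.
move=> tr1; rewrite (_ : tpow rho N = tens (fun=> rho)) // tensM tens_tr.
rewrite (bigD1 l) //= eqxx big1 ?mulr1 // => x /negPf ->.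
by rewrite mul1mx.
Qed.

Lemma tpow_tr (rho : 'M[C]_d) : \tr rho = 1 -> \tr (tpow rho N) = 1.
Proof. by move=> tr1; rewrite (tens_tr (fun=> rho)) big1. Qed.

Lemma psd_gram n (B : 'M[C]_n) : psd (adj B *m B).
Proof.
move=> v; rewrite mulmxA -adjM -mulmxA mxE sumr_ge0 // => i _.
by rewrite adjE mulrC mul_conjC_ge0.
Qed.

(** The tensor power of a Gram matrix is the Gram matrix of the tensor power, so a factor of [rho]
    transfers positivity. *)
Lemma psd_tpow (rho : 'M[C]_d) : hermitian rho -> psd rho -> psd (tpow rho N).
Proof.
move=> hr pr; have [B ->] := psd_factor hr pr.
rewrite (_ : tpow _ _ = adj (tens (fun=> B)) *m tens (fun=> B)); first exact: psd_gram.
by rewrite adj_tens tensM.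
Qed.

(** In row [i] of [site A l], only the columns [upd i l x] can carry nonzero entries. *)
Definition upd (i : 'I_dim) l (x : 'I_d) : 'I_dim :=
  enum_rank [ffun l' => if l' == l then x else cfg_of i l'].

Lemma updE i l x l' : cfg_of (upd i l x) l' = if l' == l then x else cfg_of i l'.
Proof. by rewrite /cfg_of enum_rankK ffunE. Qed.

Lemma site_upd A i l x : site A l i (upd i l x) = A (cfg_of i l) x.
Proof.
rewrite mxE (bigD1 l) //= eqxx updE eqxx big1 ?mulr1 // => l' /negPf l'l.
by rewrite l'l updE l'l mxE eqxx.
Qed.

Lemma upd_site A j l x : site A l (upd j l x) j = A x (cfg_of j l).
Proof.
rewrite mxE (bigD1 l) //= eqxx updE eqxx big1 ?mulr1 // => l' /negPf l'l.
by rewrite l'l updE l'l mxE eqxx.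
Qed.

Lemma site_eq0 A l i j l' : l' != l -> cfg_of i l' != cfg_of j l' -> site A l i j = 0.
Proof.
by move=> /negPf l'l /negPf ij; rewrite mxE (bigD1 l') //= l'l mxE ij mul0r.
Qed.

(** In either product one intermediate index survives, since [h] fixes battery [l] and [site A l]
    fixes all the others; the two remaining entries of [h] agree because [h] is blind to the state
    of battery [l]. *)
Lemma acts_on_siteC (S : {set 'I_N}) (h : 'M[C]_dim) A l :
  acts_on S h -> l \notin S -> site A l *m h = h *m site A l.
Proof.
move=> [h0 hinv] lS; apply/matrixP => i j; rewrite !mxE.

rewrite (bigD1 (upd i l (cfg_of j l))) //= big1 ?addr0; last first.
  move=> k /cfg_neq[l']; rewrite updE; case: (eqVneq l' l) => [->|l'l] kl.
    by rewrite h0 ?mulr0 //; exists l; split => //; exact/eqP.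
  by rewrite (site_eq0 _ l'l) ?mul0r // eq_sym.
rewrite (bigD1 (upd j l (cfg_of i l))) //= big1 ?addr0; last first.
  move=> k /cfg_neq[l']; rewrite updE; case: (eqVneq l' l) => [->|l'l] kl.
    by rewrite h0 ?mul0r //; exists l; split => //; apply/eqP; rewrite eq_sym.
  by rewrite (site_eq0 _ l'l) ?mulr0.
rewrite site_upd upd_site mulrC; congr (_ * _).
(* If [i] and [j] differ at another battery outside [S], both entries vanish; otherwise the
   invariance in [acts_on] identifies them. *)
have [/existsP[l' /andP[l'S /andP[l'l ij]]]|] :=
  boolP [exists l', (l' \notin S) && ((l' != l) && (cfg_of i l' != cfg_of j l'))].
  rewrite !h0 //; exists l'; split => //; rewrite updE (negPf l'l); exact/eqP.
rewrite negb_exists => /forallP eqij; apply: hinv => l' l'S.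
  have l'l : (l' == l) = false by apply: contraNF lS => /eqP <-.
  by rewrite !updE l'l.
rewrite !updE; case: eqVneq => [->|l'l] //.
by move: (eqij l'); rewrite l'S l'l /= negbK => /eqP ->.
Qed.

End tensor.

(** * Bounds on the power *)

Section power.
Variables (R : realType) (d N : nat).
Local Notation C := R[i].
Local Notation dim := (dimN d N).
Variable A : 'M[C]_d.
Hypotheses (hA : hermitian A) (AA : A *m A = 1%:M).
Local Notation site := (@site R d N A).

Let isqrt2 : C := ((Num.sqrt 2)^-1)%:C%C.

Lemma conj_isqrt2 : isqrt2^* = isqrt2.
Proof. by apply/conj_Creal; rewrite ger0_real // ler0c invr_ge0 sqrtr_ge0. Qed.

Lemma sqr_isqrt2 : isqrt2 * isqrt2 = 2^-1.
Proof.
rewrite -rmorphM -expr2 exprVn sqr_sqrtr //.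
by rewrite fmorphV rmorph_nat.
Qed.

(** For [z] equal to ['i] or [- 'i] this is the quarter-turn [exp (z * pi / 4 * A_l)], because [A]
    squares to one. *)
Definition rot1 (z : C) l := isqrt2 *: (1%:M + z *: site l).

Lemma rot1_unitary z l : z^* = - z -> z * z = -1 -> adj (rot1 z l) *m rot1 z l = 1%:M.
Proof.
move=> zc zz; rewrite /rot1 adjZ adjD adj1 adjZ adj_site // conj_isqrt2 zc.
rewrite -scalemxAl -scalemxAr scalerA sqr_isqrt2 mulmxDl mul1mx mulmxDr mulmx1.
rewrite -scalemxAl -scalemxAr siteM AA site1 scalerA mulNr zz opprK scale1r.
by move: (site l) 1%:M => x y; apply/matrixP => p q; rewrite !mxE; field.
Qed.

Lemma rot1_comm z l (X : 'M[C]_dim) : site l *m X = X *m site l ->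
  rot1 z l *m X = X *m rot1 z l.
Proof.
move=> AX; rewrite /rot1 -scalemxAl -scalemxAr; congr (_ *: _).
by rewrite mulmxDl mulmxDr mul1mx mulmx1 -scalemxAl -scalemxAr AX.
Qed.

Definition rot z (L : seq 'I_N) := foldr (fun l M => rot1 z l *m M) 1%:M L.

Lemma rot_unitary z L : z^* = - z -> z * z = -1 -> adj (rot z L) *m rot z L = 1%:M.
Proof.
move=> zc zz; elim: L => [|l L IH] /=; first by rewrite adj1 mul1mx.
by rewrite adjM mulmxA -(mulmxA (adj (rot z L))) rot1_unitary // mulmx1.
Qed.

Lemma rot_comm z L (X : 'M[C]_dim) : (forall l, l \in L -> site l *m X = X *m site l) ->
  rot z L *m X = X *m rot z L.
Proof.
elim: L => [|l L IH] AX /=; first by rewrite mul1mx mulmx1.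
rewrite -mulmxA IH => [|x xL]; last by apply: AX; rewrite inE xL orbT.
by rewrite !mulmxA rot1_comm // AX // mem_head.
Qed.

(** Copies on distinct batteries commute, so any chosen factor can be moved to the right end; in a
    conjugation the other factors then act first. *)
Lemma rot_rem z L l : uniq L -> l \in L -> rot z L = rot z (rem l L) *m rot1 z l.
Proof.
elim: L => [//|x L IH] /= /andP[xL uL]; rewrite inE.
have [->|lx] /= := eqVneq l x.
  move=> _; apply: rot1_comm; symmetry; apply: rot_comm => y yL; apply: siteC.
  by apply: contraNneq xL => <-.
by move=> lL; rewrite /= IH // mulmxA.
Qed.

Lemma rot_conj_out z L (h : 'M[C]_dim) : z^* = - z -> z * z = -1 ->
  (forall l, l \in L -> site l *m h = h *m site l) ->
  adj (rot z L) *m h *m rot z L = h.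
Proof.
move=> zc zz AX; have e := rot_comm z AX.
by rewrite -mulmxA -e mulmxA rot_unitary // mul1mx.
Qed.

Lemma rot_conj_in z L l (h : 'M[C]_dim) : z^* = - z -> z * z = -1 ->
  uniq L -> l \in L -> (forall x, x \in rem l L -> site x *m h = h *m site x) ->
  adj (rot z L) *m h *m rot z L = adj (rot1 z l) *m h *m rot1 z l.
Proof.
move=> zc zz uL lL AX; have e := rot_conj_out zc zz AX.
by rewrite (rot_rem z uL lL) adjM mulmxA -[in RHS]e !mulmxA.
Qed.

(** The terms [h] and [A_l h A_l] are common to both conjugates and cancel; the cross terms add up
    to the commutator. *)
Lemma rot1_conj_diff (z w : C) (h : 'M[C]_dim) l :
  z^* = w -> w^* = z -> w = - z ->
  adj (rot1 z l) *m h *m rot1 z l - adj (rot1 w l) *m h *m rot1 w l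
  = z *: (h *m site l - site l *m h).
Proof.
move=> zc wc wz; rewrite /rot1 !adjZ !adjD !adj1 !adjZ !adj_site // conj_isqrt2 zc wc.
rewrite -!scalemxAl -!scalemxAr !scalerA sqr_isqrt2 -scalerBr.
rewrite !(mulmxDl, mulmxDr) !mul1mx !mulmx1 -!scalemxAl -!scalemxAr.
move: (h *m site l) (site l *m h *m site l) (site l *m h) => x y v.
by apply/matrixP => p q; rewrite !mxE wz; field.
Qed.

Lemma comm_sum_out (r : seq 'I_N) (h : 'M[C]_dim) :
  (forall l, l \in r -> site l *m h = h *m site l) ->
  h *m (\sum_(l <- r) site l) - (\sum_(l <- r) site l) *m h = 0.
Proof.
move=> AX; apply/eqP; rewrite subr_eq0; apply/eqP.
by rewrite mulmx_sumr mulmx_suml big_seq [RHS]big_seq; apply: eq_bigr => l /AX.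
Qed.

(* The quarter-turns [rot z L] and [rot w L] turn a commutator with the sum
   of the local reflections into a difference of two conjugates of [h]. *)
Lemma rot_conj_diff (z w : C) (S : {set 'I_N}) (h : 'M[C]_dim) (L : seq 'I_N) :
  z^* = w -> w^* = z -> w = - z -> z * z = -1 -> w * w = -1 ->
  acts_on S h -> uniq L -> {in L &, forall l l', l \in S -> l' \in S -> l = l'} ->
  adj (rot z L) *m h *m rot z L - adj (rot w L) *m h *m rot w L
  = z *: (h *m (\sum_(l <- L) site l) - (\sum_(l <- L) site l) *m h).
Proof.
move=> zc wc wz zz ww hS uL LS.
have zcN : z^* = - z by rewrite zc.
have wcN : w^* = - w by rewrite wc wz opprK.
(* If the block misses [L], then [h] commutes with every factor and both sides are zero; otherwise
   only the factor of the one common battery acts. *)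
have [/hasP[l lL lS]|noS] := boolP (has (mem S) L); last first.
  have AX l : l \in L -> site l *m h = h *m site l.
    move=> lL; apply: acts_on_siteC hS _; apply: contra noS => lS.
    by apply/hasP; exists l.
  rewrite (comm_sum_out AX) scaler0.
  by rewrite -[RHS](subrr h); congr (_ - _); apply: rot_conj_out.
have AX x : x \in rem l L -> site x *m h = h *m site x.
  rewrite mem_rem_uniq // inE => /andP[/= xl xL].
  apply: acts_on_siteC hS _; apply: contra xl => xS.
  by apply/eqP; exact: LS.
rewrite (perm_big _ (perm_to_rem lL)) big_cons mulmxDl mulmxDr opprD addrACA.
rewrite (comm_sum_out AX) addr0 -(rot1_conj_diff _ _ zc wc wz).
by congr (_ - _); apply: rot_conj_in.
Qed.

Lemma reCD (x y : C) : reC (x + y) = reC x + reC y.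
Proof. by case: x; case: y. Qed.

Lemma reCN (x : C) : reC (- x) = - reC x.
Proof. by case: x. Qed.

Lemma reC_sum I (r : seq I) (p : pred I) (F : I -> C) :
  reC (\sum_(i <- r | p i) F i) = \sum_(i <- r | p i) reC (F i).
Proof. by elim/big_rec2: _ => // i x y _ <-; rewrite reCD. Qed.

Lemma reCZ (a : R) (x : C) : reC (a%:C%C * x) = a * reC x.
Proof. by case: x => x y; rewrite /reC /= mul0r subr0. Qed.

Lemma rot_conj_bound z L (H P : 'M[C]_dim) : z^* = - z -> z * z = -1 ->
  hermitian H -> psd P ->
  `|reC (\tr (adj (rot z L) *m H *m rot z L *m P))| <= opnorm H * reC (\tr P).
Proof.
move=> zc zz hH pP; pose V := rot z L.
have -> : \tr (adj V *m H *m V *m P) = \tr (H *m (V *m P *m adj V)).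
  by rewrite -!mulmxA mxtrace_mulC !mulmxA.
have -> : \tr P = \tr (V *m P *m adj V).
  by rewrite mxtrace_mulC mulmxA rot_unitary // mul1mx.
by apply: mxtrace_hermitian_psd => //; exact: psd_conj.
Qed.

Lemma conj_sum n (I : finType) (V : 'M[C]_n) (h : I -> 'M[C]_n) (W : 'M[C]_n) :
  V *m (\sum_mu h mu) *m W = \sum_mu V *m h mu *m W.
Proof. by rewrite mulmx_sumr mulmx_suml. Qed.

(** One unitary [rot z L] serves all blocks at once, so the commutator is a difference of two
    conjugates of the whole [H] and costs twice [opnorm H], however many blocks there are. *)
Lemma transversal_power_bound (I : finType) (S : I -> {set 'I_N})
    (h : I -> 'M[C]_dim) (L : seq 'I_N) (P H B : 'M[C]_dim) (z : C) :
  z^* = - z -> z * z = -1 ->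
  (forall mu, acts_on (S mu) (h mu) /\ hermitian (h mu)) -> uniq L ->
  (forall mu, {in L &, forall l l', l \in S mu -> l' \in S mu -> l = l'}) ->
  psd P -> H = \sum_mu h mu -> B = \sum_(l <- L) site l ->
  `|reC (\tr (z *: (H *m B - B *m H) *m P))| <= 2 * opnorm H * reC (\tr P).
Proof.
move=> zc zz hS uL LS pP HE BE.
have [w wz] : exists w, w = - z by exists (- z).
have wc : w^* = - w by rewrite wz rmorphN /= zc.
have ww : w * w = -1 by rewrite wz mulrNN.
have hH : hermitian H.
  by rewrite HE /hermitian adj_sum; apply: eq_bigr => mu _; case: (hS mu).
have -> : z *: (H *m B - B *m H) =
    adj (rot z L) *m H *m rot z L - adj (rot w L) *m H *m rot w L.
  rewrite HE; apply: etrans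
    (congr2 (fun x y => x - y) (esym (conj_sum _ h _)) (esym (conj_sum _ h _))).
  rewrite mulmx_suml mulmx_sumr -!sumrB scaler_sumr; apply: eq_bigr => mu _.
  have [hmu _] := hS mu; rewrite BE; symmetry.
  have zw : z^* = w by rewrite zc wz.
  have wzc : w^* = z by rewrite wc wz opprK.
  exact: rot_conj_diff zw wzc wz zz ww hmu uL (LS mu).
rewrite mulmxBl raddfB /= reCD reCN; apply: le_trans (ler_normB _ _) _.
rewrite -mulrA mulr_natl mulr2n; apply: lerD; apply: rot_conj_bound => //.
Qed.

(* Number the elements of each block. *)
Lemma block_colouring (I : finType) (S : I -> {set 'I_N}) k :
  (forall mu nu, mu != nu -> [disjoint S mu & S nu]%B) ->
  (forall mu, #|S mu| <= k.+1)%N ->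
  exists col : 'I_N -> 'I_k.+1,
    forall mu l l', l \in S mu -> l' \in S mu -> col l = col l' -> l = l'.
Proof.
move=> dS cS.
(* Batteries outside every block receive the colour [ord0]; no condition concerns them. *)
exists (fun l => if [pick mu | l \in S mu] is Some mu
                 then inord (index l (enum (S mu))) else ord0).
have pickS mu l : l \in S mu -> [pick mu | l \in S mu] = Some mu.
  move=> lmu; case: pickP => [nu lnu|/(_ mu)]; last by rewrite lmu.
  congr Some; apply/eqP; apply: contraT => /dS.
  by move=> /disjointFr/(_ lnu); rewrite lmu.
move=> mu l l' lmu l'mu; rewrite !(pickS mu) // => /(congr1 val) /=.
have idx x : x \in S mu -> (index x (enum (S mu)) < k.+1)%N.
  by move=> xS; apply: leq_trans (cS mu); rewrite cardE index_mem mem_enum.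
rewrite !inordK ?idx // => e.
have nthS x : x \in S mu -> nth l (enum (S mu)) (index x (enum (S mu))) = x.
  by move=> xS; rewrite nth_index // mem_enum.
by rewrite -[LHS](nthS _ lmu) e nthS.
Qed.

(** The colours split the batteries into [k] classes that meet every block at most once, and
    [transversal_power_bound] applies to each class. *)
Lemma power_bound (I : finType) (S : I -> {set 'I_N}) (h : I -> 'M[C]_dim) k
    (P H B : 'M[C]_dim) (z : C) :
  z^* = - z -> z * z = -1 ->
  (forall mu nu, mu != nu -> [disjoint S mu & S nu]%B) ->
  (forall mu, #|S mu| <= k)%N -> (0 < k)%N ->
  (forall mu, acts_on (S mu) (h mu) /\ hermitian (h mu)) ->
  psd P -> H = \sum_mu h mu -> B = \sum_l site l ->
  `|reC (\tr (z *: (H *m B - B *m H) *m P))| <= 2 * k%:R * opnorm H * reC (\tr P).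
Proof.
case: k => // k zc zz dS cS _ hS pP HE BE.
have [col colP] := block_colouring dS cS.
pose L (j : 'I_k.+1) := [seq l <- index_enum 'I_N | col l == j].
have -> : z *: (H *m B - B *m H) = \sum_(j < k.+1) z *: (H *m (\sum_(l <- L j) site l)
    - (\sum_(l <- L j) site l) *m H).
  rewrite -scaler_sumr sumrB -mulmx_sumr -mulmx_suml.
  suff -> : B = \sum_(j < k.+1) \sum_(l <- L j) site l by [].
  rewrite BE (partition_big col xpredT) //=.
  by apply: eq_bigr => j _; rewrite big_filter.
rewrite mulmx_suml raddf_sum reC_sum; apply: le_trans (ler_norm_sum _ _ _) _.
rewrite [leRHS](_ : _ = \sum_(j < k.+1) 2 * opnorm H * reC (\tr P)); last first.
  by rewrite sumr_const card_ord -[RHS]mulr_natr; ring.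
apply: ler_sum => j _.
have uL : uniq (L j) by rewrite filter_uniq // index_enum_uniq.
apply: (transversal_power_bound zc zz hS uL) pP HE _ => //.
move=> mu l l'; rewrite !mem_filter => /andP[/eqP cl _] /andP[/eqP cl' _] lS l'S.
by apply: (colP mu) => //; rewrite cl cl'.
Qed.

End power.

(** A Cauchy-Schwarz estimate with a free weight [t]: the left-hand side is a difference of
    expectations of [H] in the unnormalised states [X P X^*] for [X = 1 + z t Q] and
    [X = 1 - z t Q], divided by [2 t]. It is small when [P] has little weight on [Q] and [t] is
    large. *)
Lemma projector_power_bound (R : realType) n (H Q P : 'M[R[i]]_n) (t : R) (z : R[i]) :
  z^* = - z -> z * z = -1 -> 0 < t ->
  hermitian H -> hermitian Q -> Q *m Q = Q -> psd P ->
  `|reC (\tr (z *: (H *m Q - Q *m H) *m P))| <=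
   opnorm H * (t^-1 * reC (\tr P) + t * reC (\tr (Q *m P))).
Proof.
move=> zc zz t0 hH hQ QQ pP.
have [w wz] : exists w, w = - z by exists (- z).
have wc : w^* = - w by rewrite wz rmorphN /= zc.
have ww : w * w = -1 by rewrite wz mulrNN.
pose X (s : R[i]) := 1%:M + (s * t%:C%C) *: Q.
have tc : (t%:C%C)^* = t%:C%C by apply/conj_Creal; rewrite ger0_real // ler0c ltW.
have XE s : s^* = - s -> s * s = -1 -> X s *m P *m adj (X s) =
    P + (t ^+ 2)%:C%C *: (Q *m P *m Q) + (t%:C%C * s) *: (Q *m P - P *m Q).
  move=> sc ss; rewrite /X adjD adj1 adjZ hQ rmorphM /= tc sc.
  rewrite !(mulmxDl, mulmxDr) !mul1mx !mulmx1 -!scalemxAl -!scalemxAr !scalerA.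
  rewrite (_ : s * t%:C%C * (- s * t%:C%C) = (t ^+ 2)%:C%C); last first.
    by rewrite expr2 rmorphM -[RHS]mulr1 -(opprK 1) -ss; ring.
  move: (Q *m P *m Q) (Q *m P) (P *m Q) => x y v.
  by apply/matrixP => p q; rewrite !mxE; ring.
have trX s : s^* = - s -> s * s = -1 -> reC (\tr (X s *m P *m adj (X s))) =
    reC (\tr P) + t ^+ 2 * reC (\tr (Q *m P)).
  move=> sc ss; rewrite XE // !mxtraceD !mxtraceZ raddfB /= (mxtrace_mulC P Q).
  by rewrite subrr mulr0 addr0 reCD reCZ (mxtrace_mulC (Q *m P)) mulmxA QQ.
have bnd s : s^* = - s -> s * s = -1 -> `|reC (\tr (H *m (X s *m P *m adj (X s))))| <=
    opnorm H * (reC (\tr P) + t ^+ 2 * reC (\tr (Q *m P))).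
  move=> sc ss; rewrite -(trX s) //; apply: mxtrace_hermitian_psd => //; exact: psd_conj.
have b1 := bnd z zc zz.
have b2 := bnd w wc ww.
have XD : X z *m P *m adj (X z) - X w *m P *m adj (X w) =
    (2 * t)%:C%C *: (z *: (Q *m P - P *m Q)).
  apply: etrans (congr2 (fun x y => x - y) (XE z zc zz) (XE w wc ww)) _.
  have -> : (2 * t)%:C%C = 2 * t%:C%C :> R[i] by rewrite rmorphM rmorph_nat.
  move: (Q *m P *m Q) (Q *m P) (P *m Q) => x y v.
  by apply/matrixP => p q; rewrite !mxE wz; ring.
have key : 2 * t * reC (\tr (z *: (H *m Q - Q *m H) *m P)) =
   reC (\tr (H *m (X z *m P *m adj (X z)))) -
   reC (\tr (H *m (X w *m P *m adj (X w)))).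
  rewrite -reCN -reCD -raddfB /= -mulmxBr XD.
  rewrite -scalemxAr mxtraceZ reCZ; congr (_ * reC _).
  rewrite -scalemxAl -scalemxAr !mxtraceZ; congr (_ * _).
  rewrite mulmxBl mulmxBr !raddfB /= -!mulmxA; congr (_ - _).
  by rewrite (mxtrace_mulC Q) !mulmxA.
have t2 : 0 < 2 * t by rewrite mulr_gt0.
rewrite -(ler_pM2l t2) -{1}(gtr0_norm t2) -normrM key.
apply: le_trans (ler_normB _ _) _; apply: le_trans (lerD b1 b2) _.
rewrite le_eqVlt; apply/orP; left; apply/eqP.
by field; rewrite gt_eqF.
Qed.

(** * Differentiation of matrix-valued functions *)

Section calculus.
Variable R : realType.
Local Notation C := R[i].

(** Puts a derivative into the form of slope bound used by [locally_lipschitz_le_integral]. *)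
Lemma is_derive_locally_lipschitz (f : R -> R) (x df e : R) :
  is_derive x 1 f df -> 0 < e -> exists2 d, 0 < d &
  forall y, `|y - x| < d -> `|f y - f x| <= (`|df| + e) * `|y - x|.
Proof.
move=> fd e0; have dx : derivable f x 1 by exact: ex_derive.
have Ddf : 'D_1 f x = df by exact: derive_val.
have /cvgrPdist_lt/(_ e e0) : h^-1 *: (f (h *: 1 + x) - f x) @[h --> 0^'] --> df.
  by rewrite -Ddf; exact: dx.
rewrite near_withinE => /nbhs_ballP[d /= d0 sub].
exists d => // y yx; have [->|yneq] := eqVneq y x.
  by rewrite !subrr normr0 mulr0.
have h0 : y - x != 0 by rewrite subr_eq0.
have := sub (y - x); rewrite /ball /= sub0r normrN => /(_ yx h0).
rewrite [_ *: 1]mulr1 subrK => lt.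
have hpos : 0 < `|y - x| by rewrite normr_gt0.
rewrite -ler_pdivrMr // -normf_div mulrC.
move: lt; rewrite /GRing.scale /= => lt.
have := ler_normD (df) ((y - x)^-1 * (f y - f x) - df).
rewrite [df + _]addrC subrK => /le_trans; apply.
by rewrite lerD2l ltW // distrC.
Qed.

Lemma imCD (x y : C) : imC (x + y) = imC x + imC y.
Proof. by case: x; case: y. Qed.

Lemma reCM (x y : C) : reC (x * y) = reC x * reC y - imC x * imC y.
Proof. by case: x; case: y. Qed.

Lemma imCM (x y : C) : imC (x * y) = reC x * imC y + imC x * reC y.
Proof. by case: x; case: y. Qed.

(** Differentiation goes through real and imaginary parts, to match [schrod_step]. *)
Definition cderiv (u : R -> C) (t : R) (du : C) :=
  is_derive t 1 (fun s => reC (u s)) (reC du) /\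
  is_derive t 1 (fun s => imC (u s)) (imC du).

Definition ccont (u : R -> C) (a b : R) :=
  {within `[a, b], continuous (fun s => reC (u s))} /\
  {within `[a, b], continuous (fun s => imC (u s))}.

Lemma cderiv_cst (z : C) t : cderiv (fun=> z) t 0.
Proof. by split; exact: is_derive_cst. Qed.

Lemma ccont_cst (z : C) a b : ccont (fun=> z) a b.
Proof. by split=> x; exact: cvg_cst. Qed.

Lemma cderivD u v t du dv : cderiv u t du -> cderiv v t dv ->
  cderiv (fun s => u s + v s) t (du + dv).
Proof.
move=> [u1 u2] [v1 v2]; split.
- rewrite reCD (_ : (fun s => _) = (fun s => reC (u s)) + (fun s => reC (v s))).
    exact: is_deriveD.
  by apply/funext => s; rewrite reCD.
- rewrite imCD (_ : (fun s => _) = (fun s => imC (u s)) + (fun s => imC (v s))).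
    exact: is_deriveD.
  by apply/funext => s; rewrite imCD.
Qed.

Lemma ccontD u v a b : ccont u a b -> ccont v a b -> ccont (fun s => u s + v s) a b.
Proof.
move=> [u1 u2] [v1 v2]; split.
- rewrite (_ : (fun s => _) = (fun s => reC (u s) + reC (v s))).
    by move=> x; apply: continuousD; [exact: u1 | exact: v1].
  by apply/funext => s; rewrite reCD.
- rewrite (_ : (fun s => _) = (fun s => imC (u s) + imC (v s))).
    by move=> x; apply: continuousD; [exact: u2 | exact: v2].
  by apply/funext => s; rewrite imCD.
Qed.

Lemma cderivM u v t du dv : cderiv u t du -> cderiv v t dv ->
  cderiv (fun s => u s * v s) t (du * v t + u t * dv).
Proof.
move=> [u1 u2] [v1 v2]; split.
- rewrite (_ : (fun s => _) = (fun s => reC (u s)) * (fun s => reC (v s))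
                              - (fun s => imC (u s)) * (fun s => imC (v s))).
    apply: (is_derive_eq (is_deriveB (is_deriveM u1 v1) (is_deriveM u2 v2))).
    rewrite /GRing.scale /=.
    by rewrite reCD !reCM; ring.
  by apply/funext => s; rewrite reCM.
- rewrite (_ : (fun s => _) = (fun s => reC (u s)) * (fun s => imC (v s))
                              + (fun s => imC (u s)) * (fun s => reC (v s))).
    apply: (is_derive_eq (is_deriveD (is_deriveM u1 v2) (is_deriveM u2 v1))).
    rewrite /GRing.scale /=.
    by rewrite imCD !imCM; ring.
  by apply/funext => s; rewrite imCM.
Qed.

Lemma ccontM u v a b : ccont u a b -> ccont v a b -> ccont (fun s => u s * v s) a b.
Proof.
move=> [u1 u2] [v1 v2]; split.
- rewrite (_ : (fun s => _) = (fun s => reC (u s) * reC (v s) - imC (u s) * imC (v s))).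
    move=> x; apply: cvgB; apply: cvgM;
      [exact: u1 | exact: v1 | exact: u2 | exact: v2].
  by apply/funext => s; rewrite reCM.
- rewrite (_ : (fun s => _) = (fun s => reC (u s) * imC (v s) + imC (u s) * reC (v s))).
    move=> x; apply: cvgD; apply: cvgM;
      [exact: u1 | exact: v2 | exact: u2 | exact: v1].
  by apply/funext => s; rewrite imCM.
Qed.

Lemma reC_conj (z : C) : reC z^* = reC z. Proof. by case: z. Qed.
Lemma imC_conj (z : C) : imC z^* = - imC z. Proof. by case: z. Qed.

Lemma cderiv_conj u t du : cderiv u t du -> cderiv (fun s => (u s)^*) t du^*.
Proof.
move=> [u1 u2]; split.
- rewrite reC_conj; under eq_fun do rewrite reC_conj; exact: u1.
- rewrite imC_conj; under eq_fun do rewrite imC_conj; exact: is_deriveN.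
Qed.

Lemma ccont_conj u a b : ccont u a b -> ccont (fun s => (u s)^*) a b.
Proof.
move=> [u1 u2]; split.
- rewrite (_ : (fun s => _) = (fun s => reC (u s))) //.
  by apply/funext => s; rewrite reC_conj.
- rewrite (_ : (fun s => _) = (fun s => - imC (u s))).
    by move=> x; apply: cvgN; exact: u2.
  by apply/funext => s; rewrite imC_conj.
Qed.

Lemma cderiv_sum (I : Type) (r : seq I) (u : I -> R -> C) t (du : I -> C) :
  (forall i, cderiv (u i) t (du i)) ->
  cderiv (fun s => \sum_(i <- r) u i s) t (\sum_(i <- r) du i).
Proof.
move=> ud; elim: r => [|i r IH].
  by rewrite big_nil; under eq_fun do rewrite big_nil; exact: cderiv_cst.
by rewrite big_cons; under eq_fun do rewrite big_cons; exact: cderivD.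
Qed.

Lemma ccont_sum (I : Type) (r : seq I) (u : I -> R -> C) a b :
  (forall i, ccont (u i) a b) -> ccont (fun s => \sum_(i <- r) u i s) a b.
Proof.
move=> ud; elim: r => [|i r IH].
  by under eq_fun do rewrite big_nil; exact: ccont_cst.
by under eq_fun do rewrite big_cons; exact: ccontD.
Qed.

Definition mderiv m n (U : R -> 'M[C]_(m, n)) t (D : 'M[C]_(m, n)) :=
  forall i j, cderiv (fun s => U s i j) t (D i j).

Definition mcont m n (U : R -> 'M[C]_(m, n)) a b :=
  forall i j, ccont (fun s => U s i j) a b.

Lemma mderiv_cst m n (M : 'M[C]_(m, n)) t : mderiv (fun=> M) t 0.
Proof. by move=> i j; rewrite mxE; exact: cderiv_cst. Qed.

Lemma mcont_cst m n (M : 'M[C]_(m, n)) a b : mcont (fun=> M) a b.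
Proof. by move=> i j; exact: ccont_cst. Qed.

Lemma mderivM m n p (U : R -> 'M[C]_(m, n)) (V : R -> 'M[C]_(n, p)) t D E :
  mderiv U t D -> mderiv V t E ->
  mderiv (fun s => U s *m V s) t (D *m V t + U t *m E).
Proof.
move=> dU dV i j; rewrite !mxE -big_split /=; under eq_fun do rewrite mxE.
by apply: cderiv_sum => k; exact: cderivM.
Qed.

Lemma mcontM m n p (U : R -> 'M[C]_(m, n)) (V : R -> 'M[C]_(n, p)) a b :
  mcont U a b -> mcont V a b -> mcont (fun s => U s *m V s) a b.
Proof.
move=> dU dV i j; under eq_fun do rewrite mxE.
by apply: ccont_sum => k; exact: ccontM.
Qed.

Lemma mderiv_adj m n (U : R -> 'M[C]_(m, n)) t D :
  mderiv U t D -> mderiv (fun s => adj (U s)) t (adj D).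
Proof.
by move=> dU i j; rewrite adjE; under eq_fun do rewrite adjE; exact: cderiv_conj.
Qed.

Lemma mcont_adj m n (U : R -> 'M[C]_(m, n)) a b :
  mcont U a b -> mcont (fun s => adj (U s)) a b.
Proof.
by move=> dU i j; under eq_fun do rewrite adjE; exact: ccont_conj.
Qed.

(** Cyclicity of the trace moves the generator from the observable to the state: the Heisenberg form
    on the left, the Schrodinger form on the right. *)
Lemma trace_generator n (z : C) (H B P V W : 'M[C]_n) :
  \tr (z *: (H *m B - B *m H) *m (V *m P *m W)) =
  \tr (B *m (- z *: (H *m V) *m P *m W + V *m P *m (z *: (W *m H)))).
Proof.
rewrite -scalemxAl mxtraceZ mulmxBl raddfB /= mulmxDr raddfD /=.
rewrite -2![in RHS]scalemxAl -3![in RHS]scalemxAr !mxtraceZ.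
rewrite mulNr mulrBr [in RHS]addrC; congr (_ - _); congr (_ * _).
  by rewrite -(mulmxA H) [LHS]mxtrace_mulC !mulmxA.
by rewrite !mulmxA.
Qed.

(** * Expectation values along the evolution *)

Section expectation.
Variables (n : nat) (H U : R -> 'M[C]_n) (P B : 'M[C]_n).

Definition evolved t := U t *m P *m adj (U t).
Definition expect t := reC (\tr (B *m evolved t)).

Lemma expect_continuous a b : schrod_step H U a b ->
  {within `[a, b], continuous expect}.
Proof.
move=> sch.
have cU : mcont U a b by move=> i j; have [c1 [c2 _]] := sch i j.
have cE : mcont (fun t => B *m evolved t) a b.
  apply: mcontM; first exact: mcont_cst.
  apply: mcontM; last exact: mcont_adj.
  by apply: mcontM => //; exact: mcont_cst.
suff : ccont (fun t => \tr (B *m evolved t)) a b by case.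
by apply: ccont_sum => i; exact: cE.
Qed.

Lemma expect_derive a b t : schrod_step H U a b -> a < t < b -> hermitian (H t) ->
  is_derive t 1 expect (reC (\tr ('i *: (H t *m B - B *m H t) *m evolved t))).
Proof.
move=> sch tab hH; pose D := - 'i *: (H t *m U t).
have dU : mderiv U t D.
  by move=> i j; rewrite /D -complexiE; have [_ [_ /(_ t tab)]] := sch i j.
have dE := mderivM (mderiv_cst B t) (mderivM (mderivM dU (mderiv_cst P t)) (mderiv_adj dU)).
suff [d1 _] : cderiv (fun s => \tr (B *m evolved s)) t
    (\tr ('i *: (H t *m B - B *m H t) *m evolved t)) by exact: d1.
rewrite (_ : \tr _ = \tr (0 *m evolved t + B *m ((D *m P + U t *m 0) *m adj (U t) +
    U t *m P *m adj D))).
  by apply: cderiv_sum => i; exact: dE.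
rewrite mul0mx add0r mulmx0 addr0 /D adjZ adjM hH rmorphN /= conjCi opprK.
exact: trace_generator.
Qed.

End expectation.

End calculus.

(** * Circuit protocols *)

Section steps.
Variables (R : realType) (T : R) (m : nat) (tau : nat -> R).
Hypothesis ts : time_steps T m tau.
Local Notation mu := (@lebesgue_measure R).

Lemma time_steps_le r s : (r <= s <= m)%N -> tau r <= tau s.
Proof.
case: ts => _ [_ lt]; elim: s => [|s IH]; first by rewrite leqn0 => /andP[/eqP ->].
move=> /andP[rs sm]; move: rs; rewrite leq_eqVlt ltnS => /orP[/eqP-> //|rs].
by apply: le_trans (ltW (lt s sm)); apply: IH; rewrite rs ltnW.
Qed.

Lemma steps_le_integral (F g : R -> R) :
  (forall t, 0 <= g t) -> mu.-integrable `[0, T] (fun t => (g t)%:E) ->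
  (forall r, (r < m)%N -> {within `[tau r, tau r.+1], continuous F}) ->
  (forall r, (r < m)%N -> forall x, tau r < x < tau r.+1 ->
     forall e : R, 0 < e -> exists2 d : R, 0 < d &
     forall y, `|y - x| < d -> `|F y - F x| <= (g x + e) * `|y - x|) ->
  ((F T - F 0)%:E <= \int[mu]_(t in `[0%R, T]) (g t)%:E)%E.
Proof.
move=> g0 ig cF lF; case: (ts) => t0 [tm lt].
suff H r : (r <= m)%N ->
    ((F (tau r) - F 0)%:E <= \int[mu]_(t in `[0%R, tau r]) (g t)%:E)%E.
  by rewrite -{1 2}tm; exact: H.
elim: r => [_|r IH rm].
  by rewrite t0 subrr integral_ge0 // => x _; rewrite lee_fin.
have r0 : 0 <= tau r by rewrite -t0; apply: time_steps_le; rewrite leq0n ltnW.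
have rT : tau r.+1 <= T by rewrite -tm; apply: time_steps_le; rewrite rm leqnn.
have rr := lt r rm.
have mgT : measurable_fun `[0, T] (fun t => (g t)%:E) by exact: measurable_int ig.
have sub a b : 0 <= a -> b <= T -> `[a, b]%classic `<=` (`[0, T]%classic : set R).
  by move=> a0 bT; apply: subset_itv; rewrite bnd_simp.
have ig' : mu.-integrable `[tau r, tau r.+1] (fun t => (g t)%:E).
  by apply: integrableS ig => //; exact: sub.
have st := locally_lipschitz_le_integral rr (cF r rm) g0 ig' (lF r rm).
have -> : F (tau r.+1) - F 0 = (F (tau r) - F 0) + (F (tau r.+1) - F (tau r)) by ring.
rewrite EFinD; apply: le_trans (leeD (IH (ltnW rm)) st) _.
(* The new piece is taken half-open to be disjoint from the old one; the lost endpoint does not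
   change the integral. *)
have mo : measurable_fun `]tau r, tau r.+1] (fun t => (g t)%:E).
  apply: measurable_funS mgT => //; apply: subset_trans (sub _ _ r0 rT).
  by apply: subset_itv; rewrite bnd_simp.
rewrite -(integral_itv_obnd_cbnd mo) -ge0_integral_setU //=.
- by rewrite -itv_bndbnd_setU ?bnd_simp // ltW.
- rewrite -itv_bndbnd_setU ?bnd_simp //; last exact: ltW.
  by apply: measurable_funS mgT => //; exact: sub.
- by move=> x _; rewrite lee_fin.
- apply/disj_setPS => x [/=]; rewrite !in_itv /= => /andP[_ xr] /andP[rx _].
  by move: rx; rewrite ltNge xr.
Qed.

Lemma steps_const (F : R -> R) :
  (forall r, (r < m)%N -> {within `[tau r, tau r.+1], continuous F}) ->
  (forall r, (r < m)%N -> forall x, tau r < x < tau r.+1 -> is_derive x 1 F 0) ->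
  forall r, (r < m)%N -> forall x, tau r <= x <= tau r.+1 -> F x = F 0.
Proof.
move=> cF dF; case: (ts) => t0 [tm lt].
have one r x : (r < m)%N -> tau r <= x <= tau r.+1 -> F x = F (tau r).
  move=> rm /andP[rx xr]; apply/eqP; rewrite -subr_eq0.
  have [c _ ->] : exists2 c, c \in `[tau r, x]%R & F x - F (tau r) = 0 * (x - tau r).
    apply: (@MVT_segment _ F (fun=> 0)) => // [c|].
      by rewrite in_itv /= => /andP[rc cx]; apply: (dF r) => //; rewrite rc (lt_le_trans cx).
    apply: continuous_subspaceW (cF r rm).
    by apply: subset_itv; rewrite bnd_simp.
  by rewrite mul0r.
have all r : (r <= m)%N -> F (tau r) = F 0.
  elim: r => [_|r IH rm]; first by rewrite t0.
  by rewrite (one r) ?IH ?(ltnW rm) // lexx (ltW (lt r rm)).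
by move=> r rm x xr; rewrite (one r) // all // ltnW.
Qed.

End steps.

(** * Auxiliary facts for the strict work bound *)

Section site_linear.
Variables (R : realType) (d N : nat).
Local Notation C := R[i].

Lemma siteE (A : 'M[C]_d) (l : 'I_N) i j : site A l i j =
  A (cfg_of i l) (cfg_of j l) * \prod_(l' | l' != l) (1%:M : 'M[C]_d) (cfg_of i l') (cfg_of j l').
Proof.
rewrite mxE (bigD1 l) //= eqxx; congr (_ * _).
by apply: eq_bigr => l' /negPf ->.
Qed.

Lemma siteD (A B : 'M[C]_d) (l : 'I_N) : site (A + B) l = site A l + site B l.
Proof. by apply/matrixP => i j; rewrite [RHS]mxE !siteE mxE mulrDl. Qed.

Lemma siteZ c (A : 'M[C]_d) (l : 'I_N) : site (c *: A) l = c *: site A l.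
Proof. by apply/matrixP => i j; rewrite [RHS]mxE !siteE mxE mulrA. Qed.

End site_linear.

Section arithmetic.
Variable R : realType.

Lemma min_lipschitz (theta a b : R) : `|Num.min a theta - Num.min b theta| <= `|a - b|.
Proof.
have ba : b - a <= `|a - b| by rewrite distrC ler_norm.
have ab := ler_norm (a - b); rewrite ler_norml.
by case: (leP a theta); case: (leP b theta) => *; apply/andP; split; lra.
Qed.

(** With [a] the number of batteries and the weight [4 * a] in [projector_power_bound], each of the
    two terms is at most 1 / 4; this fixes the constants 4 and 8. *)
Lemma slow_start_arith (a s : R) : 0 < a -> 2 * s <= (8 * a)^-1 ->
  2 * ((4 * a)^-1 * a + 4 * a * s) <= 1.
Proof.
move=> a0 s8; have -> : (4 * a)^-1 * a = 4^-1 by field; rewrite gt_eqF.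
have : 4 * a * (2 * s) <= 4 * a * (8 * a)^-1 by rewrite ler_pM2l // mulr_gt0.
have -> : 4 * a * (8 * a)^-1 = 2^-1 by field; rewrite gt_eqF.
by move: (4 * a) => c; rewrite mulrCA => h; rewrite mulrDr; lra.
Qed.

(** Here [p] is the power at the slow start, [o] the norm of the Hamiltonian and [c] the interaction
    order; the doubled slope stays within the general bound since [c] is at least 1. *)
Lemma double_lipschitz_arith (D w p o c e : R) : D <= (p + e / 2) * w -> 0 <= w ->
  p <= o -> 0 <= o -> 1 <= c -> D + D <= (2 * c * o + e) * w.
Proof.
move=> Dw w0 po o0 c1; have oc : o <= c * o by rewrite ler_peMl.
apply: le_trans (lerD Dw Dw) _; rewrite -mulrDl ler_wpM2r //; lra.
Qed.

Lemma comm_affine n (z : R[i]) (H Q : 'M[R[i]]_n) :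
  z *: (H *m (2 *: Q - 1%:M) - (2 *: Q - 1%:M) *m H) =
  (2%:R : R)%:C%C *: (z *: (H *m Q - Q *m H)).
Proof.
rewrite rmorph_nat mulmxBr mulmxBl mulmx1 mul1mx -scalemxAr -scalemxAl.
move: (H *m Q) (Q *m H) => a b.
by apply/matrixP => i j; rewrite !mxE; ring.
Qed.

End arithmetic.

(** * Work bounds for a circuit protocol *)

Section circuit.
Variables (R : realType) (d N k : nat).
Local Notation C := R[i].
Local Notation dim := (dimN d N).
Local Notation mu := (@lebesgue_measure R).
Variables (Hs U : R -> 'M[C]_dim) (Ts : R) (m : nat) (tau : nat -> R).
Variables (S : nat -> 'I_(ceil_div N k) -> {set 'I_N}).
Variables (h : nat -> 'I_(ceil_div N k) -> R -> 'M[C]_dim).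
Variables (rho sigma A : 'M[C]_d).
Hypothesis k0 : (0 < k)%N.
Hypotheses (circ : circuit_protocol Hs Ts m tau S h) (intH : norm_integrable Hs Ts).
Hypotheses (prop : propagator Hs U Ts m tau).
Hypotheses (drho : density rho) (dsigma : density sigma).
Hypothesis final : U Ts *m tpow rho N *m adj (U Ts) = tpow sigma N.
Hypotheses (hA : hermitian A) (AA : A *m A = 1%:M).

Let P t := evolved U (tpow rho N) t.
Let B := \sum_l @site R d N A l.
Let f := expect U (tpow rho N) B.

Lemma psd_evolved t : psd (P t).
Proof. by case: drho => hr [_ pr]; apply: psd_conj; exact: psd_tpow. Qed.

Lemma circuit_steps : time_steps Ts m tau. Proof. by case: circ. Qed.

Lemma circuit_schrod r : (r < m)%N -> schrod_step Hs U (tau r) (tau r.+1).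
Proof. by case: prop => _ [_]; apply. Qed.

Lemma circuit_hermitian r t : (r < m)%N -> tau r < t < tau r.+1 -> hermitian (Hs t).
Proof.
move=> rm tr; case: circ => _ /(_ r rm)[_ [_ [hS /(_ t tr) ->]]].
by rewrite /hermitian adj_sum; apply: eq_bigr => nu _; case: (hS nu t).
Qed.

Lemma evolved0 : P 0 = tpow rho N.
Proof. by case: prop => _ [U0 _]; rewrite /P /evolved U0 adj1 mulmx1 mul1mx. Qed.

(** The trace is the expectation of the identity, whose commutator with the Hamiltonian vanishes;
    this stands in for a proof that [U] is unitary. *)
Lemma circuit_trace r t : (r < m)%N -> tau r <= t <= tau r.+1 -> reC (\tr (P t)) = 1.
Proof.
move=> rm tr; pose F := expect U (tpow rho N) 1%:M.
have FE s : F s = reC (\tr (P s)) by rewrite /F /expect mul1mx.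
rewrite -FE (steps_const circuit_steps (F := F) _ _ rm tr).
- by rewrite FE evolved0 tpow_tr //; case: drho => _ [].
- by move=> q qm; exact: expect_continuous (circuit_schrod qm).
- move=> q qm x xq.
  have := expect_derive (tpow rho N) 1%:M (circuit_schrod qm) xq (circuit_hermitian qm xq).
  by rewrite mulmx1 mul1mx subrr scaler0 mul0mx mxtrace0.
Qed.

(** The rate of change of [f], the expectation of the sum of the reflections, rather than of the
    stored energy. *)
Definition power t := reC (\tr ('i *: (Hs t *m B - B *m Hs t) *m P t)).

Lemma circuit_derive r t : (r < m)%N -> tau r < t < tau r.+1 -> is_derive t 1 f (power t).
Proof.
by move=> rm tr; exact: expect_derive (circuit_schrod rm) tr (circuit_hermitian rm tr).
Qed.

Lemma conj_imaginary : ('i : C)^* = - 'i. Proof. exact: conjCi. Qed.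
Lemma sqr_imaginary : ('i : C) * 'i = -1. Proof. by rewrite -expr2 sqrCi. Qed.

Lemma circuit_power_bound r t : (r < m)%N -> tau r < t < tau r.+1 ->
  `|power t| <= 2 * k%:R * opnorm (Hs t).
Proof.
move=> rm tr; case: circ => _ /(_ r rm)[dS [cS [hS /(_ t tr) HsE]]].
have := power_bound hA AA conj_imaginary sqr_imaginary dS cS k0
  (fun nu => hS nu t) (psd_evolved t) HsE (erefl B).
by rewrite (circuit_trace rm) ?mulr1 //; case/andP: tr => *; rewrite !ltW.
Qed.

Lemma expect0 : f 0 = N%:R * reC (\tr (A *m rho)).
Proof.
rewrite /f /expect -/(P 0) evolved0 /B mulmx_suml raddf_sum reC_sum /=.
have tr1 : \tr rho = 1 by case: drho => _ [].
under eq_bigr do rewrite (site_tpow_tr _ _ tr1).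
by rewrite sumr_const card_ord mulr_natl.
Qed.

Lemma expectT : f Ts = N%:R * reC (\tr (A *m sigma)).
Proof.
rewrite /f /expect /evolved final /B mulmx_suml raddf_sum reC_sum /=.
have tr1 : \tr sigma = 1 by case: dsigma => _ [].
under eq_bigr do rewrite (site_tpow_tr _ _ tr1).
by rewrite sumr_const card_ord mulr_natl.
Qed.

Lemma integrable_scaled_norm (c : R) : mu.-integrable `[0, Ts] (fun t => (c * opnorm (Hs t))%:E).
Proof.
rewrite (_ : (fun t => _) = (fun t => c%:E * (opnorm (Hs t))%:E)%E) //.
by apply: integrableZl => //; exact: measurable_itv.
Qed.

Lemma integral_scaled_norm (c : R) :
  (\int[mu]_(t in `[0%R, Ts]) (c * opnorm (Hs t))%:E = c%:E * norm_integral Hs Ts)%E.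
Proof.
under eq_integral do rewrite EFinM.
by rewrite integralZl //; exact: measurable_itv.
Qed.

(** At the two product states [f] is [N] times a single-battery expectation, and in between its
    slope is at most [2 * k%:R * opnorm (Hs t)]. *)
Lemma work_bound :
  ((N%:R * (reC (\tr (A *m sigma)) - reC (\tr (A *m rho))))%:E <=
   (2 * k%:R)%:E * norm_integral Hs Ts)%E.
Proof.
rewrite mulrBr -expectT -expect0 -integral_scaled_norm.
apply: (steps_le_integral circuit_steps) => //.
- by move=> t; rewrite mulr_ge0 // opnorm_ge0.
- exact: integrable_scaled_norm.
- by move=> r rm; exact: expect_continuous (circuit_schrod rm).
- move=> r rm x xr e e0.
  have [dd dd0 dP] := is_derive_locally_lipschitz (circuit_derive rm xr) e0.
  exists dd => // y yx; apply: le_trans (dP y yx) _.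
  by rewrite ler_wpM2r // lerD2r (circuit_power_bound rm).
Qed.

(* While the batteries are almost in their initial state the power is small;
   doubling the part of [f] below [theta] makes this gain visible. *)
Lemma work_bound_strict : (0 < N)%N ->
  reC (\tr (A *m rho)) = -1 -> reC (\tr (A *m sigma)) = 1 ->
  ((2 * N%:R + (8 * N%:R)^-1)%:E <= (2 * k%:R)%:E * norm_integral Hs Ts)%E.
Proof.
move=> N0 Arho Asigma.
have N0' : 0 < N%:R :> R by rewrite ltr0n.
(* The initial value of [f] is [- N]; the offset is the one required by [slow_start_arith]. *)
pose theta : R := - N%:R + (8 * N%:R)^-1.
pose F t := f t + Num.min (f t) theta.
have e8 : 0 < (8 * N%:R)^-1 :> R by rewrite invr_gt0 mulr_gt0.
have e8' : (8 * N%:R)^-1 <= 1 :> R.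
  by rewrite invf_le1 ?mulr_gt0 // -natrM ler1n muln_gt0.
have N1 : 1 <= N%:R :> R by rewrite ler1n.
have k1 : 1 <= k%:R :> R by rewrite ler1n.
have f0 : f 0 = - N%:R by rewrite expect0 Arho mulrN1.
have fT : f Ts = N%:R by rewrite expectT Asigma mulr1.
have F0 : F 0 = - 2 * N%:R.
  by rewrite /F f0 min_l /theta; [ring | lra].
have FT : F Ts = (8 * N%:R)^-1.
  by rewrite /F fT min_r /theta; [ring | lra].
have -> : 2 * N%:R + (8 * N%:R)^-1 = F Ts - F 0 by rewrite F0 FT; ring.
rewrite -integral_scaled_norm.
apply: (steps_le_integral circuit_steps) => //.
- by move=> t; rewrite mulr_ge0 // opnorm_ge0.
- exact: integrable_scaled_norm.
- move=> r rm.
  have cf : {within `[tau r, tau r.+1], continuous f}.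
    exact: expect_continuous (circuit_schrod rm).
  move=> x; apply: continuousD; first exact: cf.
  by apply: continuous_min; [exact: cf | exact: cvg_cst].
move=> r rm x xr e e0.
have e20 : 0 < e / 2 by rewrite divr_gt0.
have [d1 d10 dP] := is_derive_locally_lipschitz (circuit_derive rm xr) e20.
have [fx|fx] := leP (f x) theta.
  (* Below the threshold the power is so small that twice it still obeys the general bound. *)
  have small : `|power x| <= opnorm (Hs x).
    (* [Q] projects onto the eigenvalue 1 of [A]; the sum of its expectations is half of [f x + N],
       hence tiny below the threshold. *)
    pose Q : 'M[C]_d := 2^-1 *: (1%:M + A).
    have hQ : hermitian Q.
      by rewrite /Q /hermitian adjZ adjD adj1 hA fmorphV rmorph_nat.
    have QQ : Q *m Q = Q.
      rewrite /Q -scalemxAl -scalemxAr mulmxDl !mulmxDr !mul1mx mulmx1 AA.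
      by move: 1%:M => Id; apply/matrixP => i j; rewrite !mxE; field.
    have AQ : A = 2 *: Q - 1%:M.
      by rewrite /Q scalerA divff ?pnatr_eq0 // scale1r addrC addKr.
    have siteA l : site A l = 2 *: site Q l - 1%:M :> 'M[C]_dim.
      by rewrite {1}AQ -scaleN1r siteD !siteZ site1 scaleN1r.
    have trP : reC (\tr (P x)) = 1.
      by rewrite (circuit_trace rm) //; case/andP: xr => *; rewrite !ltW.
    have fE : f x = 2 * \sum_l reC (\tr (@site R d N Q l *m P x)) - N%:R.
      rewrite /f /expect -/(P x) /B mulmx_suml raddf_sum reC_sum /= mulr_sumr.
      have NE : N%:R = \sum_(l < N) 1 :> R by rewrite sumr_const card_ord.
      rewrite [X in _ - X]NE -sumrB; apply: eq_bigr => l _.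
      rewrite siteA mulmxBl mul1mx raddfB /= reCD reCN trP; congr (_ - _).
      by rewrite -scalemxAl mxtraceZ -(@rmorph_nat _ _ (real_complex R)) reCZ.
    pose t0 : R := 4 * N%:R.
    have t00 : 0 < t0 by rewrite mulr_gt0.
    have hH := circuit_hermitian rm xr.
    have bl l : `|reC (\tr ('i *: (Hs x *m site A l - site A l *m Hs x) *m P x))| <=
        2 * (opnorm (Hs x) * (t0^-1 + t0 * reC (\tr (@site R d N Q l *m P x)))).
      have sQ : @site R d N Q l *m site Q l = site Q l by rewrite siteM QQ.
      have bq := projector_power_bound conj_imaginary sqr_imaginary t00 hH
        (adj_site l hQ) sQ (psd_evolved x).
      apply: (@le_trans _ _ (2 * (opnorm (Hs x) * (t0^-1 * reC (\tr (P x))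
        + t0 * reC (\tr (@site R d N Q l *m P x)))))); last by rewrite trP mulr1.
      rewrite siteA comm_affine -scalemxAl mxtraceZ reCZ normrM normr_nat ler_pM2l //.
    have -> : power x = \sum_l reC (\tr ('i *: (Hs x *m site A l - site A l *m Hs x) *m P x)).
      rewrite -reC_sum -raddf_sum -mulmx_suml -scaler_sumr sumrB /=.
      by rewrite -mulmx_sumr -mulmx_suml.
    apply: le_trans (ler_norm_sum _ _ _) _.
    apply: le_trans (ler_sum _ (fun l _ => bl l)) _.
    rewrite -mulr_sumr -mulr_sumr big_split /= sumr_const card_ord -mulr_sumr.
    set s := \sum_l _ in fE *.
    have s0 : 2 * s <= (8 * N%:R)^-1 by move: fx; rewrite fE /theta addrC lerD2l.
    rewrite mulrCA ler_piMr ?opnorm_ge0 // -[_ *+ N]mulr_natr.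
    exact: slow_start_arith.
  exists d1 => // y yx.
  have := dP y yx; set D := `|f y - f x| => Dle.
  have : `|F y - F x| <= D + D.
    rewrite /F opprD addrACA; apply: le_trans (ler_normD _ _) _.
    by rewrite lerD2l; exact: min_lipschitz.
  move=> /le_trans; apply.
  exact: double_lipschitz_arith Dle (normr_ge0 _) small (opnorm_ge0 _) k1.
pose K := 2 * k%:R * opnorm (Hs x) + e.
have K0 : 0 < K by rewrite ltr_wpDl // mulr_ge0 // opnorm_ge0.
have fle y : `|y - x| < d1 -> `|f y - f x| <= K * `|y - x|.
  move=> /dP /le_trans; apply; rewrite ler_wpM2r //; apply: lerD.
    exact: circuit_power_bound rm xr.
  by rewrite ler_pdivrMr // ler_peMr ?(ltW e0) // ler1n.
(* The second radius keeps [f y] above [theta], where the minimum in [F] is constant. *)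
exists (Num.min d1 ((f x - theta) / K)).
  by rewrite lt_min d10 divr_gt0 // subr_gt0.
move=> y; rewrite lt_min => /andP[y1 y2].
have fy : theta <= f y.
  move: (y2); rewrite ltr_pdivlMr // mulrC => lt2.
  have := le_lt_trans (fle y y1) lt2; rewrite distrC => lt3.
  by have := le_lt_trans (ler_norm _) lt3; rewrite ltrD2l ltrN2 => /ltW.
by rewrite /F (min_r fy) (min_r (ltW fx)) opprD addrACA subrr addr0; exact: fle.
Qed.

End circuit.

(** * The two-level flip *)

Section flip.
Variables (R : realType) (n : nat) (E : R).
Local Notation C := R[i].
Hypotheses (n0 : (0 < n)%N) (E0 : 0 < E).
Local Notation a := (@ord0 n).
Local Notation b := (@ord_max n).
Local Notation mu := (@lebesgue_measure R).

Lemma ord0_neq_max : a != b. Proof. by rewrite -val_eqE /= eq_sym -lt0n. Qed.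

Definition flipH : 'M[C]_n.+1 := E%:C%C *: (delta_mx a b + delta_mx b a).

(** The exponential of [- 'i * t] times [flipH]: a rotation in the span of the two extreme levels
    and the identity on the others. *)
Definition flipU (t : R) : 'M[C]_n.+1 :=
  1%:M + (cos (E * t) - 1)%:C%C *: (delta_mx a a + delta_mx b b)
       + (- 'i%C * (sin (E * t))%:C%C) *: (delta_mx a b + delta_mx b a).

Let X : 'M[C]_n.+1 := delta_mx a b + delta_mx b a.
Let Pi : 'M[C]_n.+1 := delta_mx a a + delta_mx b b.

Lemma deltaM (i j k l : 'I_n.+1) : delta_mx i j *m delta_mx k l =
  (j == k)%:R *: delta_mx i l :> 'M[C]_n.+1.
Proof. by rewrite mul_delta_mx_cond scaler_nat. Qed.

Lemma flip_algebra : [/\ X *m X = Pi & X *m Pi = X].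
Proof.
have ab := negPf ord0_neq_max.
have ba : (b == a) = false by rewrite eq_sym.
rewrite /X /Pi; split; rewrite !mulmxDl !mulmxDr !deltaM !eqxx ?ab ba.
  by rewrite !scale0r !scale1r add0r addr0.
by rewrite !scale0r !scale1r add0r addr0 addrC.
Qed.

Lemma adj_flip : adj X = X /\ adj Pi = Pi.
Proof.
by split; apply/matrixP => i j; rewrite adjE !mxE rmorphD /= !conjC_nat addrC
  ?[(j == _) && _]andbC ?[(i == _) && _]andbC //; rewrite addrC.
Qed.

Lemma flipH_hermitian : hermitian flipH.
Proof.
rewrite /hermitian adjZ -/X; have [-> _] := adj_flip; congr (_ *: _).
by apply/conj_Creal; rewrite ger0_real // ler0c ltW.
Qed.

(** The square of [flipH] is [E ^+ 2] times a projection, so its only possible eigenvalues are 0 and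
    [E ^+ 2]. *)
Lemma flipH_opnorm : opnorm flipH <= E.
Proof.
have [XX XPi] := flip_algebra.
rewrite /opnorm; set Y := [set s | _].
have [ne|/set0P/negP/negPn/eqP->] := pselect (Y !=set0); last by rewrite sup0 ltW.
apply: ge_sup => // s [s0 /eigenvalueP[v vH v0]].
have HH : adj flipH *m flipH = (E%:C%C * E%:C%C) *: Pi.
  by rewrite flipH_hermitian /flipH -/X -scalemxAl -scalemxAr scalerA XX.
rewrite HH -scalemxAr in vH.
have PiPi : Pi *m Pi = Pi by rewrite -{1}XX -mulmxA XPi XX.
have := congr1 (fun w => w *m Pi) vH.
rewrite -!scalemxAl -mulmxA PiPi => vP.
have [vPi0|vPi0] := eqVneq (v *m Pi) 0.
  move: vH; rewrite vPi0 !scaler0 => /esym/eqP.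
  rewrite scaler_eq0 (negPf v0) orbF => /eqP/complexI/eqP.
  by rewrite expf_eq0 /= => /eqP ->; rewrite ltW.
have : (E%:C%C * E%:C%C - (s ^+ 2)%:C%C) *: (v *m Pi) = 0.
  by rewrite scalerBl vP subrr.
move/eqP; rewrite scaler_eq0 (negPf vPi0) orbF subr_eq0 -rmorphM => /eqP/complexI Es.
by rewrite -[s](ger0_norm s0) -sqrtr_sqr -Es -expr2 sqrtr_sqr gtr0_norm.
Qed.

Lemma flipU_deriv t : mderiv flipU t (- 'i%C *: (flipH *m flipU t)).
Proof.
have [XX XPi] := flip_algebra.
have HU : - 'i%C *: (flipH *m flipU t) =
    (- (E * sin (E * t)))%:C%C *: Pi + (- 'i%C * (E * cos (E * t))%:C%C) *: X.
  rewrite /flipH /flipU -/X -/Pi -scalemxAl !mulmxDr mulmx1 -!scalemxAr XX XPi.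
  rewrite !rmorphN !rmorphM rmorphB rmorph1 /=.
  move: (E%:C%C) ((sin _)%:C%C) ((cos _)%:C%C) => e s c.
  have ii : ('i%C : C) * 'i%C = -1 by rewrite -expr2 sqr_i.
  move: ('i%C : C) ii (X) (Pi) => z zz x y; apply/matrixP => i j; rewrite !mxE.
  transitivity (z * z * e * s * y i j - z * e * c * x i j); first by ring.
  by rewrite zz; ring.
move=> i j; rewrite HU.
have dc : is_derive t 1 (fun s => cos (E * s)) (- (E * sin (E * t))).
  have d1 : is_derive t 1 (fun s : R => E * s) E.
    by apply: (is_derive_eq (is_deriveZ E (is_derive_id t 1))); rewrite /GRing.scale /= mulr1.
  by apply: (is_derive_eq (is_derive1_comp (is_derive_cos (E * t)) d1)); ring.
have ds : is_derive t 1 (fun s => sin (E * s)) (E * cos (E * t)).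
  have d1 : is_derive t 1 (fun s : R => E * s) E.
    by apply: (is_derive_eq (is_deriveZ E (is_derive_id t 1))); rewrite /GRing.scale /= mulr1.
  by apply: (is_derive_eq (is_derive1_comp (is_derive_sin (E * t)) d1)); ring.
have dreal (g : R -> R) dg : is_derive t 1 g dg -> cderiv (fun s => (g s)%:C%C) t dg%:C%C.
  by move=> gd; split => //=; exact: is_derive_cst.
have dc1 : is_derive t 1 (fun s => cos (E * s) - 1) (- (E * sin (E * t))).
  rewrite (_ : (fun s => _) = (fun s => cos (E * s)) - cst 1) //.
  by apply: (is_derive_eq (is_deriveB dc (is_derive_cst (1 : R) t 1))); rewrite subr0.
have T1 := cderivM (dreal _ _ dc1) (cderiv_cst (Pi i j) t).
have T2 := cderivM (cderivM (cderiv_cst (- 'i%C) t) (dreal _ _ ds)) (cderiv_cst (X i j) t).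
have := cderivD (cderivD (cderiv_cst (1%:M i j : C) t) T1) T2.
rewrite !mul0r !mulr0 !addr0 !add0r.
rewrite (_ : (fun s => _) = (fun s => flipU s i j)).
  have mE (p q : C) : (p *: Pi + q *: X) i j = p * Pi i j + q * X i j.
    by rewrite [LHS]mxE [Y in Y + _]mxE [Y in _ + Y]mxE.
  by rewrite mE.
by apply/funext => s; rewrite /flipU -/X -/Pi !mxE.
Qed.

Lemma cos_sin_flip : cos (E * (pi / (2 * E))) = 0 /\ sin (E * (pi / (2 * E))) = 1.
Proof.
have -> : E * (pi / (2 * E)) = pi / 2 by field; rewrite gt_eqF.
by rewrite cos_pihalf sin_pihalf.
Qed.

(** At a quarter period the cosine vanishes and the sine is 1: the ground vector goes to the top
    vector up to the phase [- 'i], which cancels against its conjugate. *)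
Lemma flipU_final : let U := flipU (pi / (2 * E)) in
  U *m delta_mx a a *m adj U = delta_mx b b.
Proof.
move=> U; have [c0 s1] := cos_sin_flip.
have ab := negPf ord0_neq_max.
have ba : (b == a) = false by rewrite eq_sym.
have Ua : U *m delta_mx a a = - 'i%C *: delta_mx b a.
  rewrite /U /flipU c0 s1 sub0r rmorphN1 rmorph1 mulr1 scaleN1r.
  rewrite !mulmxDl mul1mx mulNmx -scalemxAl !mulmxDl !deltaM !eqxx ?ab ba.
  by rewrite !scale0r !scale1r addr0 subrr !add0r.
(* Writing the projection as itself times its adjoint reduces both sides of the conjugation to
   [Ua]. *)
have dd : delta_mx a a = delta_mx a a *m adj (delta_mx a a) :> 'M[C]_n.+1.
  rewrite (_ : adj _ = delta_mx a a) ?deltaM ?eqxx ?scale1r //.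
  by apply/matrixP => i j; rewrite adjE !mxE conjC_nat andbC.
rewrite dd mulmxA -mulmxA -adjM Ua adjZ -scalemxAl -scalemxAr scalerA.
rewrite (_ : adj _ = delta_mx a b); last first.
  by apply/matrixP => i j; rewrite adjE !mxE conjC_nat andbC.
rewrite deltaM eqxx scale1r complexiE rmorphN /= conjCi opprK mulNr -expr2 sqrCi opprK.
by rewrite scale1r.
Qed.

Lemma flip_integrable T : norm_integrable (fun=> flipH) T.
Proof.
apply/integrableP; split; first exact: measurable_cst.
rewrite integral_cst; last exact: measurable_itv.
have h : (mu (`[0%R, T]%classic : set R) < +oo)%E.
  by rewrite lebesgue_measure_itv /=; case: ifP => _; rewrite ?ltry // -EFinD ltry.
by apply: lte_mul_pinfty.
Qed.

Lemma flip_drives : drives (delta_mx a a) (delta_mx b b) (fun=> flipH) (pi / (2 * E)).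
Proof.
have T0 : 0 < pi / (2 * E) by rewrite divr_gt0 ?pi_gt0 // mulr_gt0.
split => //; split; first by move=> _; exact: flipH_hermitian.
split; first exact: flip_integrable.
exists flipU, 1%N, (fun r => if r is 0%N then 0 else pi / (2 * E)).
split; last exact: flipU_final.
split; first by split => //; split => // -[].
split.
  by rewrite /flipU mulr0 cos0 sin0 subrr rmorph0 mulr0 !scale0r !addr0.
case=> // _ i j.
have cont (g : R -> R) (dg : R -> R) : (forall t : R, is_derive t 1 g (dg t)) ->
    {within `[0, pi / (2 * E)], continuous g}.
  move=> gd; apply: continuous_subspaceT => t.
  apply: differentiable_continuous; apply/derivable1_diffP.
  by have := gd t => gdt; exact: ex_derive.
split; first by apply: cont => t; exact: (flipU_deriv t i j).1.
split; first by apply: cont => t; exact: (flipU_deriv t i j).2.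
by move=> t _; exact: flipU_deriv.
Qed.

Lemma flip_norm_integral :
  (((pi / (2 * E))^-1)%:E * norm_integral (fun=> flipH) (pi / (2 * E)) <= E%:E)%E.
Proof.
have T0 : 0 < pi / (2 * E) by rewrite divr_gt0 ?pi_gt0 // mulr_gt0.
have mT : mu (`[0%R, pi / (2 * E)]%classic : set R) = (pi / (2 * E))%:E.
  by rewrite lebesgue_measure_itv /= lte_fin T0 -EFinD subr0.
rewrite /norm_integral integral_cst; last exact: measurable_itv.
rewrite [X in (_ * (_ * X) <= _)%E](_ : _ = (pi / (2 * E))%:E)%E; last exact: mT.
by rewrite -!EFinM lee_fin mulrCA mulVf ?gt_eqF // mulr1 flipH_opnorm.
Qed.

End flip.

(** * The advantage bound *)

(* The sign of [sigma - rho] is a reflection that separates the two states. *)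
Lemma separating_reflection (R : realType) n (rho sigma : 'M[R[i]]_n) :
  density rho -> density sigma -> rho <> sigma ->
  exists A : 'M[R[i]]_n, [/\ hermitian A, A *m A = 1%:M &
    0 < reC (\tr (A *m sigma)) - reC (\tr (A *m rho))].
Proof.
move=> [hr _] [hs _] neq; pose M := sigma - rho.
have hM : hermitian M by rewrite /M /hermitian adjD adjN hs hr.
have [Q [d [QQ' Q'Q QM]]] := hermitian_spectrum hM.
(* The sign of 0 is taken to be 1, so that every sign squares to one. *)
pose e i : R := if 0 <= d i then 1 else -1.
have ee i : e i * e i = 1 by rewrite /e; case: ifP; rewrite ?mulr1 ?mulrNN ?mulr1.
have ed i : e i * d i = `|d i|.
  rewrite /e; case: ifPn => [d0|]; first by rewrite mul1r ger0_norm.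
  by rewrite -ltNge => d0; rewrite mulN1r ltr0_norm.
pose D : 'M[R[i]]_n := diag_mx (\row_i (e i)%:C%C).
have DD : D *m D = 1%:M.
  rewrite mulmx_diag -diag_const_mx; congr diag_mx.
  by apply/rowP => i; rewrite !mxE -rmorphM ee rmorph1.
have hD : adj D = D.
  apply/matrixP => i j; rewrite adjE !mxE eq_sym.
  case: (eqVneq i j) => [->|]; last by rewrite !mulr0n conjC0.
  by rewrite !mulr1n; apply/conj_Creal/complex_realP; exists (e j).
exists (adj Q *m D *m Q); split.
- by rewrite /hermitian !adjM adjK hD mulmxA.
- by rewrite -!mulmxA (mulmxA Q) QQ' mul1mx (mulmxA D) DD mul1mx Q'Q.
rewrite -reCN -reCD -raddfB /= -mulmxBr -/M.
(* This is the trace norm of [M], which vanishes only for [M = 0]. *)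
have -> : \tr (adj Q *m D *m Q *m M) = (\sum_i `|d i|)%:C%C.
  rewrite -!mulmxA mxtrace_mulC -!mulmxA (mulmxA Q) QM -mulmxA QQ' mulmx1.
  rewrite mulmx_diag mxtrace_diag rmorph_sum; apply: eq_bigr => i _.
  by rewrite !mxE -rmorphM ed.
rewrite /reC /= lt_neqAle sumr_ge0 // andbT eq_sym.
apply/eqP => /eqP; rewrite psumr_eq0 // => /allP d0.
apply: neq; apply/esym/eqP; rewrite -subr_eq0 -/M; apply/eqP.
rewrite -[M]mul1mx -Q'Q -mulmxA QM (_ : \row__ _ = 0) ?diag_mx0 ?raddf0 ?mul0mx ?mulmx0 //.
apply/rowP => i; rewrite !mxE; have := d0 i; rewrite mem_index_enum => /(_ isT).
by rewrite normr_eq0 => /eqP ->; rewrite rmorph0.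
Qed.

(** The reflection [1 - 2 |0><0|] reverses the ground vector and fixes all other levels. *)
Lemma ground_reflection (R : realType) n : (0 < n)%N ->
  exists A : 'M[R[i]]_n.+1, [/\ hermitian A, A *m A = 1%:M,
      reC (\tr (A *m delta_mx ord0 ord0)) = -1 &
      reC (\tr (A *m delta_mx ord_max ord_max)) = 1].
Proof.
move=> n0; have ab := @ord0_neq_max n n0.
have dM (i : 'I_n.+1) : delta_mx ord0 ord0 *m delta_mx i i =
    (ord0 == i)%:R *: delta_mx ord0 i :> 'M[R[i]]_n.+1 by rewrite deltaM.
have trd (i : 'I_n.+1) : \tr (delta_mx i i : 'M[R[i]]_n.+1) = 1.
  rewrite /mxtrace (bigD1 i) //= mxE eqxx big1 ?addr0 // => j /negPf ji.
  by rewrite mxE ji.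
pose A : 'M[R[i]]_n.+1 := 1%:M - 2 *: delta_mx ord0 ord0.
exists A; split.
- rewrite /A /hermitian adjD adj1 adjN adjZ conjC_nat; congr (_ - _ *: _).
  by apply/matrixP => i j; rewrite adjE !mxE conjC_nat andbC.
- rewrite /A mulmxBl mul1mx -scalemxAl mulmxBr mulmx1 -scalemxAr dM eqxx scale1r.
  by move: 1%:M (delta_mx _ _) => x y; apply/matrixP => i j; rewrite !mxE; ring.
- rewrite /A mulmxBl mul1mx -scalemxAl dM eqxx scale1r raddfB /= mxtraceZ trd mulr1.
  by rewrite (_ : 1 - 2 = -1) //; ring.
- by rewrite /A mulmxBl mul1mx -scalemxAl dM (negPf ab) scale0r scaler0 subr0 trd.
Qed.

Lemma norm_integral_fin (R : realType) n (H : R -> 'M[R[i]]_n) T :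
  norm_integrable H T -> (fine (norm_integral H T))%:E = norm_integral H T.
Proof. by move=> iH; rewrite fineK //; exact: integrable_fin_num iH. Qed.

Lemma norm_integral_ge0 (R : realType) n (H : R -> 'M[R[i]]_n) T :
  0 <= fine (norm_integral H T).
Proof. by apply: fine_ge0; apply: integral_ge0 => t _; rewrite lee_fin opnorm_ge0. Qed.

(** A flip of strength [E = I / Tp] has average norm at most that of the optimal protocol and takes
    the time [pi / (2 * E)]; optimality gives [Tp <= pi / (2 * E)], that is [I <= pi / 2]. *)
Lemma flip_optimal_time (R : realType) n (Hp : R -> 'M[R[i]]_n.+1) (Tp : R) :
  (0 < n)%N -> optimal_protocol (delta_mx ord0 ord0) (delta_mx ord_max ord_max) Hp Tp ->
  fine (norm_integral Hp Tp) <= pi / 2.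
Proof.
move=> n0 [[Tp0 [_ [iH _]]] opt].
set I := fine _; have I0 : 0 <= I by exact: norm_integral_ge0.
(* The flip needs a positive strength, so a vanishing integral is treated apart. *)
have [->|Ineq] := eqVneq I 0; first by rewrite divr_ge0 // pi_ge0.
have Ipos : 0 < I by rewrite lt_neqAle eq_sym Ineq.
have E0 : 0 < I / Tp by rewrite divr_gt0.
have IE : ((I / Tp)%:E = (Tp^-1)%:E * norm_integral Hp Tp)%E.
  by rewrite -(norm_integral_fin iH) -EFinM -/I [in RHS]mulrC.
have := opt _ _ (flip_drives n0 E0); rewrite -IE => /(_ (flip_norm_integral n0 E0)).
rewrite ler_pdivlMr; last by rewrite mulr_gt0.
move=> h.
have -> : I = Tp * (2 * (I / Tp)) / 2 by field; rewrite gt_eqF.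
by rewrite ler_pM2r.
Qed.

(** Here [w] is the gain per battery, and [I] and [Ip] are the norm integrals of the collective and
    the single-battery protocol; the factor [N] of the gain cancels against the one in (C0). *)
Lemma advantage_arith (R : realType) (N k w I Ip Ts Tp : R) : 0 < N -> 0 < w ->
  0 < Ts -> 0 < Tp -> N * w <= 2 * k * I -> 0 <= k ->
  Ts^-1 * I <= N / Tp * Ip -> w * (Tp / Ts) <= 2 * k * Ip.
Proof.
move=> N0 w0 Ts0 Tp0 NwI k0 C0.
have TsTp : 0 < Tp / (N * Ts) by rewrite divr_gt0 // mulr_gt0.
have I1 : I <= Ts * (N / Tp * Ip) by rewrite mulrC -ler_pdivrMr // mulrC.
have : N * w <= 2 * k * (Ts * (N / Tp * Ip)).
  by apply: le_trans NwI _; rewrite ler_wpM2l // mulr_ge0.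
rewrite -(ler_pM2r TsTp).
rewrite (_ : N * w * _ = w * (Tp / Ts)); last by field; rewrite !gt_eqF.
by rewrite (_ : 2 * k * _ * _ = 2 * k * Ip) //; field; rewrite !gt_eqF.
Qed.

(* Batteries have n.+1 levels (d = n.+1); lambda : internal spectrum. *)
Theorem theorem1 (R : realType) (n : nat) (lambda : 'I_n.+1 -> R)
  (rho sigma : 'M[R[i]]_n.+1) :
  (forall i j : 'I_n.+1, (i < j)%N -> lambda i < lambda j) ->
  0 < lambda ord_max ->
  lambda ord_max - lambda ord0 = 2 * lambda ord_max ->
  density rho -> density sigma -> rho <> sigma ->
  (forall (Hp : R -> 'M[R[i]]_n.+1) (Tp : R),
     optimal_protocol rho sigma Hp Tp ->
     exists gamma : R, advantage_bound rho sigma Hp Tp gamma) /\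
  (rho = delta_mx ord0 ord0 -> sigma = delta_mx ord_max ord_max ->
   forall (Hp : R -> 'M[R[i]]_n.+1) (Tp : R),
     optimal_protocol rho sigma Hp Tp ->
     advantage_bound rho sigma Hp Tp (pi / 2)).
Proof.
move=> _ lmax lgap dr ds neq; split.
- move=> Hp Tp [[Tp0 [_ [iHp _]]] _].
  have [A [hA AA w0]] := separating_reflection dr ds neq.
  set w := _ - _ in w0; pose Ip := fine (norm_integral Hp Tp).
  (* The work bound yields the factor [2 * Ip / w] with a weak inequality; adding 1 makes it strict,
     and neither number involves [N] or [k]. *)
  exists (2 * Ip / w + 1).
  move=> N k Hs Ts m tau S h U N0 k0 Ts0 circ iHs prp fin C0.
  have k0' : 0 < k%:R :> R by rewrite ltr0n.
  have N0' : 0 < N%:R :> R by rewrite ltr0n.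
  have := work_bound k0 circ iHs prp dr ds fin hA AA.
  rewrite -(norm_integral_fin iHs) -EFinM lee_fin -/w => wb.
  move: C0; rewrite -(norm_integral_fin iHs) -(norm_integral_fin iHp) -!EFinM lee_fin => C0.
  have := advantage_arith N0' w0 Ts0 Tp0 wb (ltW k0') C0.
  rewrite mulrC -ler_pdivlMr // => /le_lt_trans; apply.
  have -> : 2 * k%:R * fine (norm_integral Hp Tp) / w = 2 * Ip / w * k%:R by rewrite /Ip; ring.
  by rewrite ltr_pM2r // ltrDl.
- move=> rhoE sigmaE Hp Tp opt.
  (* With a single level the spectrum would have zero width, against the gap condition. *)
  have n0 : (0 < n)%N.
    rewrite lt0n; apply/eqP => n0; move: lgap; rewrite (_ : ord0 = ord_max); last first.
      by apply/val_inj; rewrite /= n0.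
    by rewrite subrr => /esym/eqP; rewrite mulf_eq0 pnatr_eq0 /= (gt_eqF lmax).
  have [A [hA AA Arho Asigma]] := ground_reflection R n0.
  have Ipi : fine (norm_integral Hp Tp) <= pi / 2.
    by apply: flip_optimal_time n0 _; rewrite -rhoE -sigmaE.
  case: opt => -[Tp0 [_ [iHp _]]] _.
  move=> N k Hs Ts m tau S h U N0 k0 Ts0 circ iHs prp fin C0.
  have k0' : 0 < k%:R :> R by rewrite ltr0n.
  have N0' : 0 < N%:R :> R by rewrite ltr0n.
  rewrite -rhoE in Arho; rewrite -sigmaE in Asigma.
  have := work_bound_strict k0 circ iHs prp dr ds fin hA AA N0 Arho Asigma.
  rewrite -(norm_integral_fin iHs) -EFinM lee_fin => wb.
  move: C0; rewrite -(norm_integral_fin iHs) -(norm_integral_fin iHp) -!EFinM lee_fin => C0.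
  (* The gain per battery in [work_bound_strict] exceeds 2 by an amount depending on [N]; the excess
     only makes the inequality strict, and the final bound uses the 2. *)
  pose w : R := 2 + (8 * N%:R)^-1 / N%:R.
  have e0 : 0 < (8 * N%:R)^-1 / N%:R :> R by rewrite divr_gt0 // invr_gt0 mulr_gt0.
  have w0 : 0 < w by rewrite addr_gt0.
  have wE : N%:R * w = 2 * N%:R + (8 * N%:R)^-1.
    by rewrite /w; field; rewrite gt_eqF.
  rewrite -wE in wb.
  have := advantage_arith N0' w0 Ts0 Tp0 wb (ltW k0') C0.
  have TT : 0 < Tp / Ts by rewrite divr_gt0.
  have lt2 : 2 * (Tp / Ts) < w * (Tp / Ts) by rewrite ltr_pM2r // ltrDl.
  move=> /(lt_le_trans lt2); rewrite -mulrA ltr_pM2l // => /lt_le_trans; apply.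
  by rewrite mulrC ler_pM2r.
Qed.
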